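(* The plan existence problem $\mathsf{PlanEx}\text{-}\mathcal{T}_{\mathrm{NFL}}$ is decidable, where $\mathcal{T}_{\mathrm{NFL}}$ is the class of attention planning tasks $T=(s_0,\Sigma,\varphi_g)$ with $\Sigma$ a finite set of No Free Lunch (NFL) attention actions. That is, there is an algorithm which, given $T\in\mathcal{T}_{\mathrm{NFL}}$, decides whether $T$ has a solution.
   Context: Language. $I\neq\emptyset$ is a finite set of agents, $N\in\mathbb{N}=\{0,1,2,\dots\}$ an attention bound, $\Phi$ a countable set of proposition atoms, $\Psi=\{(\alpha_i<n),(\alpha_i=n): n\le N, i\in I\}$ the set of attention atoms, $At=\Phi\uplus\Psi$. The language $\mathcal{L}$ is $\varphi::=\top\mid p\mid\neg\varphi\mid\varphi\wedge\varphi\mid K_i\varphi$ with $p\in At$, $i\in I$. Attention states. An attention model is $M=(W,R,V,A)$ with $W\ne\emptyset$ a finite set of worlds; $R$ assigning to each $i\in I$ an equivalence relation $R_i$ on $W$; $V:At\to\mathcal{P}(W)$ a valuation; and $A:I\times W\to\{0,\dots,N\}$ such that $wR_iv$ implies $A_i(w)=A_i(v)$. For $w\in W$, $(M,w)$ is an attention state, with actual world $w$. Satisfaction: $M,w\vDash p$ iff $w\in V(p)$ for $p\in\Phi$; $M,w\vDash(\alpha_i=n)$ iff $A_i(w)=n$; $M,w\vDash(\alpha_i<n)$ iff $A_i(w)<n$; $M,w\vDash K_i\varphi$ iff $M,v\vDash\varphi$ for all $v$ with $wR_iv$; standard clauses for $\top,\neg,\wedge$. Write $\varphi\vDash\psi$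 if every attention state satisfies $\varphi\to\psi$. Attention actions. An attention action model is $\mathcal{A}=(E,Q,Q^*,pre,c)$ with $E\neq\emptyset$ a finite set of events; $Q,Q^*$ assigning to each $i\in I$ equivalence relations $Q_i,Q_i^*$ on $E$; $pre:E\to\mathcal{L}$; and a cost function $c:I\times\mathcal{L}\times E\to\mathbb{N}$ with $c_i(\top,e)=0$ and such that $(e,e')\in Q_i\cup Q_i^*$ implies $c_i(\varphi,e)=c_i(\varphi,e')$, for all $i,\varphi$. A question map is a map $\mathsf{q}:I\to\mathcal{L}$. An attention action is a triple $X=(\mathcal{A},\mathsf{q},e)$ with $e\in E$ (the actual event). $\mathrm{NFL}$ is the class of attention actions such that, for all $i\in I$, $Q_i^*=E\times E$ and $c_i(\varphi,e)>0$ for all $e\in E$ and all $\varphi\in\mathcal{L}\setminus\{\top\}$. Attention update. Let $Q_i^*[\varphi|\neg\varphi]$ be the set of $(e,e')\in Q_i^*$ such that ($pre(e)\vDash\varphi$ iff $pre(e')\vDash\varphi$). The update of $(M,w)=((W,R,V,A),w)$ with $X=((E,Q,Q^*,pre,c),\mathsf{q},e)$ is $(M,w)^X=((W^X,R^X,V^X,A^X),(w,e))$, where $W^X=\{(v,f)\in W\times E: M,v\vDash pre(f)\}$; $((v,f),(u,g))\in R_i^X$ iff $(v,u)\in R_i$ and $(f,g)\in Q_i\cup Q_i^*$ in case $c_i(\mathsf{q}_i,f)>A_i(v)$, respectively $(f,g)\in Q_i\cup Q_i^*[\mathsf{q}_i|\neg\mathsf{q}_i]$ in case $c_i(\mathsf{q}_i,f)\le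 A_i(v)$; $V^X(p)=\{(v,f)\in W^X: v\in V(p)\}$ for $p\in\Phi$; $A_i^X(v,f)=\max\{0,A_i(v)-c_i(\mathsf{q}_i,f)\}$. $X$ is applicable to $(M,w)$ if $M,w\vDash pre(e)$. A sequence $X_1,\dots,X_n$ is applicable to $(M,w)$ if each $X_{k+1}$ is applicable to the result of updating successively with $X_1,\dots,X_k$; the final result is $(M,w)^{X_1,\dots,X_n}$. (Satisfaction and updates on updated structures are given by the same clauses.) Planning. An attention planning task is $T=(s_0,\Sigma,\varphi_g)$ with $s_0$ an attention state, $\Sigma$ a finite set of attention actions, $\varphi_g\in\mathcal{L}$. A solution to $T$ is a finite sequence $X_1,\dots,X_n$ of actions from $\Sigma$ applicable to $s_0$ with $s_0^{X_1,\dots,X_n}\vDash\varphi_g$. $\mathcal{T}_{\mathrm{NFL}}$ is the class of attention planning tasks with $\Sigma\subseteq\mathrm{NFL}$, and $\mathsf{PlanEx}\text{-}\mathcal{T}_{\mathrm{NFL}}$ is the decision problem: given $T\in\mathcal{T}_{\mathrm{NFL}}$, does $T$ have a solution? The agent set $I$ and bound $N$ are arbitrary and part of the instance; an instance is given by finite data (only finitely many atoms of $\Phi$ and the cost values $c_i(\mathsf{q}_i,f)$ are relevant). *)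

(* Defs.v *)
From mathcomp Require Import all_boot.
From mathcomp Require Import boolp.
From Stdlib Require List Relation_Operators.

Set Implicit Arguments.
Unset Strict Implicit.
Unset Printing Implicit Defensive.

(** * Language *)

Inductive atom (Phi : countType) (I : finType) (N : nat) : Type :=
| Prp of Phi
| AttLt of I & 'I_N.+1
| AttEq of I & 'I_N.+1.

Inductive form (Phi : countType) (I : finType) (N : nat) : Type :=
| Top
| At of atom Phi I N
| Neg of form Phi I N
| And of form Phi I N & form Phi I N
| K of I & form Phi I N.

Arguments Prp {Phi I N}.
Arguments AttLt {Phi I N}.
Arguments AttEq {Phi I N}.
Arguments Top {Phi I N}.

(** * Attention states *)

(* No condition is put on the relations here: since the union of two
   equivalence relations need not be transitive, an updated structure need not
   be an attention model.  The conditions are in [attention_model]. *)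
Record structure (Phi : countType) (I : finType) (N : nat) := Structure {
  world :> finType;
  acc : I -> rel world;
  val : atom Phi I N -> {set world};
  att : I -> world -> 'I_N.+1
}.

Definition equivalence (T : Type) (r : rel T) : Prop :=
  [/\ reflexive r, symmetric r & transitive r].

Definition attention_model Phi I N (M : structure Phi I N) : Prop :=
  [/\ 0 < #|M|,
      forall i, equivalence (@acc _ _ _ M i)
    & forall i (w v : M), acc i w v -> att i w = att i v].

Record state Phi I N := State {
  model :> structure Phi I N;
  actual : model
}.

Definition attention_state Phi I N (s : state Phi I N) : Prop :=
  attention_model s.

(* The values of [val] on attention atoms are never consulted. *)
Fixpoint sat Phi I N (M : structure Phi I N) (w : M) (phi : form Phi I N) :
    bool :=
  match phi with
  | Top => true
  | At (Prp p) => w \in @val _ _ _ M (Prp p)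
  | At (AttLt i n) => att i w < n
  | At (AttEq i n) => att i w == n
  | Neg psi => ~~ sat w psi
  | And psi chi => sat w psi && sat w chi
  | K i psi => [forall v, acc i w v ==> sat v psi]
  end.

Definition entails Phi I N (phi psi : form Phi I N) : Prop :=
  forall s : state Phi I N,
    attention_state s -> sat (actual s) phi -> sat (actual s) psi.

(** * Attention actions *)

Record action_model (Phi : countType) (I : finType) (N : nat) := ActionModel {
  event :> finType;
  event_gt0 : 0 < #|event|;
  dep : I -> rel event; (* Q *)
  qdep : I -> rel event; (* Q^* *)
  pre : event -> form Phi I N;
  cost : I -> form Phi I N -> event -> nat;
  dep_equiv : forall i, equivalence (dep i);
  qdep_equiv : forall i, equivalence (qdep i);
  cost_top : forall i e, cost i Top e = 0;
  cost_compat : forall i phi e e',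
    dep i e e' || qdep i e e' -> cost i phi e = cost i phi e'
}.

Record action Phi I N := Action {
  amodel :> action_model Phi I N;
  question : I -> form Phi I N;
  actual_event : amodel
}.

Definition NFL Phi I N (X : action Phi I N) : Prop :=
  forall i, (forall e e' : X, qdep i e e') /\
            (forall (phi : form Phi I N) (e : X), phi <> Top -> 0 < cost i phi e).

(** * Update *)

(* Q^*_i[phi | ~phi] *)
Definition qdep_refine Phi I N (E : action_model Phi I N) (i : I)
    (phi : form Phi I N) : rel E :=
  fun e e' => qdep i e e' && `[< entails (pre e) phi <-> entails (pre e') phi >].

Section Update.
Context {Phi : countType} {I : finType} {N : nat}.
Context (M : structure Phi I N) (X : action Phi I N).

Definition upd_world : finType := {x : M * X | sat x.1 (pre x.2)}.

Definition upd_acc (i : I) : rel upd_world := fun x y =>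
  let: (v, f) := \val x in
  let: (u, g) := \val y in
  acc i v u &&
  (dep i f g ||
   (if att i v < cost i (question X i) f then qdep i f g
    else qdep_refine i (question X i) f g)).

Definition upd_val (p : atom Phi I N) : {set upd_world} :=
  [set x | (\val x).1 \in @val _ _ _ M p].

Definition upd_att (i : I) (x : upd_world) : 'I_N.+1 :=
  let: (v, f) := \val x in
  Ordinal (leq_ltn_trans (leq_subr (cost i (question X i) f) (att i v))
                         (ltn_ord (att i v))).

Definition update : structure Phi I N := Structure upd_acc upd_val upd_att.

End Update.

Definition applicable Phi I N (s : state Phi I N) (X : action Phi I N) : Prop :=
  sat (actual s) (pre (actual_event X)).

Definition update_state Phi I N (s : state Phi I N) (X : action Phi I N)
    (h : applicable s X) : state Phi I N :=
  @State _ _ _ (update s X)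
    (exist (fun x : s * X => sat x.1 (pre x.2))
           (actual s, actual_event X) h).

(** * Planning *)

Record task (Phi : countType) := Task {
  agent : finType;
  agent_gt0 : 0 < #|agent|;
  bound : nat;
  init : state Phi agent bound;
  init_attention : attention_state init;
  actions : seq (action Phi agent bound);
  goal : form Phi agent bound
}.

Fixpoint achieves Phi I N (s : state Phi I N) (Xs : seq (action Phi I N))
    (phi : form Phi I N) : Prop :=
  match Xs with
  | [::] => sat (actual s) phi
  | X :: Xs' => exists h : applicable s X, achieves (update_state h) Xs' phi
  end.

Definition has_solution Phi (T : task Phi) : Prop :=
  exists Xs, (forall X, List.In X Xs -> List.In X (actions T)) /\
             achieves (init T) Xs (goal T).

Definition NFL_task Phi (T : task Phi) : Prop :=
  forall X, List.In X (actions T) -> NFL X.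

(** * Decidability

    The model of computation is the weak call-by-value lambda-calculus with de
    Bruijn indices, which is Turing complete.  Only closed terms are ever
    substituted, so substitution needs no shifting. *)

Inductive term : Type := Var of nat | App of term & term | Lam of term.

Fixpoint closed_at (k : nat) (s : term) : bool :=
  match s with
  | Var n => n < k
  | App s t => closed_at k s && closed_at k t
  | Lam s => closed_at k.+1 s
  end.

Fixpoint subst (s : term) (k : nat) (u : term) : term :=
  match s with
  | Var n => if n == k then u else Var n
  | App s t => App (subst s k u) (subst t k u)
  | Lam s => Lam (subst s k.+1 u)
  end.

Inductive step : term -> term -> Prop :=
| step_beta s t : step (App (Lam s) (Lam t)) (subst s 0 (Lam t))
| step_appl s s' t : step s s' -> step (App s t) (App s' t)
| step_appr s t t' : step t t' -> step (App s t) (App s t').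

Definition reduces : term -> term -> Prop := Relation_Operators.clos_refl_trans term step.

(* Scott encoding of the [k]-th of [n] constructors applied to closed
   arguments: [fun x_0 ... x_(n-1) => x_k args]. *)
Definition scott (n k : nat) (args : seq term) : term :=
  iter n Lam (foldl App (Var (n - k.+1)) args).

Definition enc_bool (b : bool) : term := scott 2 (if b then 0 else 1) [::].

(* The decision problem "given [x] in the class [C], does [P x] hold?", where
   the input [x] is presented as the closed term [enc x]. *)
Definition decidable_problem (T : Type) (enc : T -> term) (C P : T -> Prop) :
    Prop :=
  exists2 u : term, closed_at 0 u &
    forall x, C x ->
      (P x /\ reduces (App u (enc x)) (enc_bool true)) \/
      (~ P x /\ reduces (App u (enc x)) (enc_bool false)).

(** * Encoding of planning tasks

    Elements of a finite type are presented by their rank, functions on a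
    finite type by the list of their values, propositional atoms by their
    [pickle] number.  Of the infinite components of a task, only the valuation
    of the propositional atoms occurring in the task and the costs of the
    questions actually asked are presented. *)

Definition enc_nat (n : nat) : term :=
  iter n (fun t => scott 2 1 [:: t]) (scott 2 0 [::]).

Definition enc_seq (s : seq term) : term :=
  foldr (fun x t => scott 2 1 [:: x; t]) (scott 2 0 [::]) s.

Definition enc_tuple (s : seq term) : term := scott 1 0 s.

Definition enc_elt (T : finType) (x : T) : term := enc_nat (enum_rank x).

Definition enc_fun (T : finType) (f : T -> term) : term :=
  enc_seq [seq f x | x <- enum T].

Definition enc_rel (T : finType) (r : rel T) : term :=
  enc_fun (fun x => enc_fun (fun y => enc_bool (r x y))).

Definition enc_atom Phi I N (a : atom Phi I N) : term :=
  match a with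
  | Prp p => scott 3 0 [:: enc_nat (pickle p)]
  | AttLt i n => scott 3 1 [:: enc_elt i; enc_nat n]
  | AttEq i n => scott 3 2 [:: enc_elt i; enc_nat n]
  end.

Fixpoint enc_form Phi I N (phi : form Phi I N) : term :=
  match phi with
  | Top => scott 5 0 [::]
  | At a => scott 5 1 [:: enc_atom a]
  | Neg psi => scott 5 2 [:: enc_form psi]
  | And psi chi => scott 5 3 [:: enc_form psi; enc_form chi]
  | K i psi => scott 5 4 [:: enc_elt i; enc_form psi]
  end.

Fixpoint form_props Phi I N (phi : form Phi I N) : seq Phi :=
  match phi with
  | Top => [::]
  | At (Prp p) => [:: p]
  | At _ => [::]
  | Neg psi => form_props psi
  | And psi chi => form_props psi ++ form_props chi
  | K _ psi => form_props psi
  end.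

Definition action_props (Phi : countType) (I : finType) N (X : action Phi I N) :
    seq Phi :=
  flatten [seq form_props (pre e) | e <- enum X] ++
  flatten [seq form_props (question X i) | i <- enum I].

Definition task_props Phi (T : task Phi) : seq Phi :=
  undup (flatten [seq action_props X | X <- actions T] ++ form_props (goal T)).

Definition enc_state (Phi : countType) (I : finType) N (ps : seq Phi) (s : state Phi I N) :
    term :=
  enc_tuple
    [:: enc_fun (fun i : I => enc_rel (@acc _ _ _ s i));
        enc_seq [seq enc_tuple
                       [:: enc_nat (pickle p);
                           enc_fun (fun w : s =>
                             enc_bool (w \in @val _ _ _ s (Prp p)))]
                | p <- ps];
        enc_fun (fun i : I => enc_fun (fun w : s => enc_nat (att i w)));
        enc_elt (actual s)].

Definition enc_action (Phi : countType) (I : finType) N (X : action Phi I N) : term :=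
  enc_tuple
    [:: enc_fun (fun i : I => enc_rel (@dep _ _ _ X i));
        enc_fun (fun i : I => enc_rel (@qdep _ _ _ X i));
        enc_fun (fun e : X => enc_form (pre e));
        enc_fun (fun i : I =>
          enc_fun (fun e : X => enc_nat (cost i (question X i) e)));
        enc_fun (fun i : I => enc_form (question X i));
        enc_elt (actual_event X)].

Definition enc_task Phi (T : task Phi) : term :=
  enc_tuple
    [:: enc_nat #|agent T|;
        enc_nat (bound T);
        enc_state (task_props T) (init T);
        enc_seq [seq enc_action X | X <- actions T];
        enc_form (goal T)].

(* Main.v *)
Require Import Defs.
From mathcomp Require Import all_boot.
From mathcomp Require Import boolp.
From Stdlib Require List Relation_Operators.

Set Implicit Arguments.
Unset Strict Implicit.
Unset Printing Implicit Defensive.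

(** If every agent who still has attention asks nothing ([Top]), an NFL update
    is bisimilar to the restriction of the model to the worlds satisfying some
    precondition: it either changes nothing, and can be dropped from the plan,
    or loses a world.  Any other NFL update lowers the maximal attention of
    some agent, and there are at most [#|I| * N] of those.  Hence a solvable
    task has a solution of computable length, and exhaustive search decides.
    Updates are effective because filtration through the boxed subformulas and
    the attention levels bounds the models to be inspected to decide the
    entailments in [Q^*].

    The program is never written as a lambda-term: the functions computed by
    closed terms are closed under composition, pairing and structural
    iteration, and the search is a function of that kind. *)

(** * Computability in the weak lambda-calculus *)

(** Where the NFL conditions enter: [qdep] is total, so an agent who asks [Top] or cannot pay for
    the question never tells events apart; and an agent who asks anything else pays a positive
    amount at every world, so that the largest level falls everywhere at once. An update multiplies
    the number of worlds by at most the number of events, and this growth counts only for the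
    boundedly many updates that consume attention: the others are traded for restrictions, which
    never grow.

    The obstacle is that the union of [dep] and [qdep] or its refinement need not be transitive, so
    that updates may leave the class of attention models. Bisimulation and search therefore treat
    arbitrary structures. Filtration does rely on equivalence relations, but it serves only the
    entailments, which range over attention states and depend on preconditions and questions, never
    on the current state. *)

Definition is_lam (t : term) : bool := if t is Lam _ then true else false.

Definition value (t : term) : bool := closed_at 0 t && is_lam t.

Lemma value_closed t : value t -> closed_at 0 t.
Proof. by rewrite /value => /andP[]. Qed.

Lemma closed_atW k l t : k <= l -> closed_at k t -> closed_at l t.
Proof.
elim: t k l => [n|s IHs t IHt|s IHs] k l le_kl /=.
- by move=> /leq_trans; apply.
- by case/andP => /(IHs _ _ le_kl)-> /(IHt _ _ le_kl).
- exact: IHs.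
Qed.

Lemma closed0 k t : closed_at 0 t -> closed_at k t.
Proof. exact: closed_atW. Qed.

Lemma subst_closed_at k l t u : k <= l -> closed_at k t -> subst t l u = t.
Proof.
elim: t k l => [n|s IHs t IHt|s IHs] k l le_kl /=.
- by move=> lt_nk; rewrite ltn_eqF // (leq_trans lt_nk).
- by case/andP => /(IHs _ _ le_kl)-> /(IHt _ _ le_kl)->.
- by move=> /(IHs k.+1 l.+1)->.
Qed.

Lemma subst_closed k t u : closed_at 0 t -> subst t k u = t.
Proof. exact: subst_closed_at. Qed.

Lemma red_refl t : reduces t t.
Proof. exact: Relation_Operators.rt_refl. Qed.

Lemma red_trans t s u : reduces s t -> reduces t u -> reduces s u.
Proof. exact: Relation_Operators.rt_trans. Qed.

Lemma red_appl s s' t : reduces s s' -> reduces (App s t) (App s' t).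
Proof.
elim=> [x y xy|x|x y z _ IH1 _ IH2]; last exact: red_trans IH1 IH2.
- by apply: Relation_Operators.rt_step; apply: step_appl.
- exact: red_refl.
Qed.

Lemma red_appr s t t' : reduces t t' -> reduces (App s t) (App s t').
Proof.
elim=> [x y xy|x|x y z _ IH1 _ IH2]; last exact: red_trans IH1 IH2.
- by apply: Relation_Operators.rt_step; apply: step_appr.
- exact: red_refl.
Qed.

Lemma red_app s' t' s t u :
  reduces s s' -> reduces t t' -> reduces (App s' t') u -> reduces (App s t) u.
Proof.
move=> rs rt; apply: red_trans.
exact: red_trans (red_appl _ rs) (red_appr _ rt).
Qed.

Lemma red_head s' s t u :
  reduces s s' -> reduces (App s' t) u -> reduces (App s t) u.
Proof. by move=> rs; apply: red_app rs (red_refl _). Qed.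

Lemma red_beta v s t u :
  value v -> reduces t v -> reduces (subst s 0 v) u ->
  reduces (App (Lam s) t) u.
Proof.
rewrite /value; case: v => [?|? ?|v] /andP[] // _ _ rt ru.
apply: red_app (red_refl _) rt _.
by apply: red_trans ru; apply: Relation_Operators.rt_step; apply: step_beta.
Qed.

Lemma red_betaV s v u :
  value v -> reduces (subst s 0 v) u -> reduces (App (Lam s) v) u.
Proof. by move=> vv; apply: red_beta (red_refl _). Qed.

(** Codes are closed abstractions because beta-reduction fires only on abstractions and substitution
    without shifting is harmless only for closed terms. *)
Class encodable (A : Type) := Encodable {
  enc : A -> term;
  enc_value : forall a, value (enc a)
}.
Arguments enc : simpl never.

Lemma enc_closed A {eA : encodable A} (a : A) k : closed_at k (enc a).
Proof. exact: closed0 (value_closed (enc_value a)). Qed.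

Lemma subst_enc A {eA : encodable A} (a : A) k u : subst (enc a) k u = enc a.
Proof. exact/subst_closed/enc_closed. Qed.

Definition computable A B {eA : encodable A} {eB : encodable B}
    (f : A -> B) : Prop :=
  exists2 u, closed_at 0 u & forall x, reduces (App u (enc x)) (enc (f x)).

Lemma enc_bool_value b : value (enc_bool b).
Proof. by case: b. Qed.

Lemma enc_nat_value n : value (enc_nat n).
Proof.
elim: n => // n /value_closed/(closed0 2); rewrite /value /= => ->.
by [].
Qed.

Lemma enc_seq_value A {eA : encodable A} (s : seq A) :
  value (enc_seq (map enc s)).
Proof.
elim: s => // a s /value_closed/(closed0 2).
by rewrite /value /= enc_closed => ->.
Qed.

Lemma enc_prod_value A B {eA : encodable A} {eB : encodable B} (p : A * B) :
  value (enc_tuple [:: enc p.1; enc p.2]).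
Proof. by rewrite /value /= !enc_closed. Qed.

Instance encodable_bool : encodable bool := Encodable enc_bool_value.
Instance encodable_nat : encodable nat := Encodable enc_nat_value.
Instance encodable_seq A {eA : encodable A} : encodable (seq A) :=
  Encodable (@enc_seq_value A eA).
Instance encodable_prod A B {eA : encodable A} {eB : encodable B} :
  encodable (A * B) :=
  Encodable (@enc_prod_value A B eA eB).

Lemma enc_natS n : enc n.+1 = Lam (Lam (App (Var 0) (enc n))).
Proof. by []. Qed.

Lemma enc_cons A {eA : encodable A} (a : A) s :
  enc (a :: s) = Lam (Lam (App (App (Var 0) (enc a)) (enc s))).
Proof. by []. Qed.

Lemma enc_pair A B {eA : encodable A} {eB : encodable B} (a : A) (b : B) :
  enc (a, b) = Lam (App (App (Var 0) (enc a)) (enc b)).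
Proof. by []. Qed.

Ltac closedness :=
  rewrite /value /= ?enc_closed; repeat (rewrite closed0; last by []); by [].

Ltac do_subst :=
  rewrite /= ?subst_enc; repeat (rewrite subst_closed; last by []).

Ltac beta :=
  apply: red_betaV;
  [first [assumption | exact: enc_value | closedness] | do_subst].

(** * Closure properties of the computable functions *)

Section Closure.
Context (C : Type) {eC : encodable C}.

Lemma comp_ext A {eA : encodable A} (f g : C -> A) :
  f =1 g -> computable f -> computable g.
Proof. by move=> fg [u cu fu]; exists u => // x; rewrite -fg. Qed.

Lemma comp_const A {eA : encodable A} (a : A) : computable (fun _ : C => a).
Proof.
exists (Lam (enc a)) => [|x]; first closedness.
by beta; apply: red_refl.
Qed.

Lemma comp_id : computable (fun c : C => c).
Proof.
exists (Lam (Var 0)) => [|x]; first closedness.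
by beta; apply: red_refl.
Qed.

Lemma comp_comp A B {eA : encodable A} {eB : encodable B} (f : A -> B)
    (a : C -> A) :
  computable f -> computable a -> computable (fun c => f (a c)).
Proof.
move=> [u cu fu] [v cv av]; exists (Lam (App u (App v (Var 0)))) => [|x].
  closedness.
beta; exact: red_app (red_refl _) (av x) (fu _).
Qed.

Definition pairT := Lam (Lam (Lam (App (App (Var 0) (Var 2)) (Var 1)))).

Lemma red_pair A B {eA : encodable A} {eB : encodable B} (a : A) (b : B) s t :
  reduces s (enc a) -> reduces t (enc b) ->
  reduces (App (App pairT s) t) (enc (a, b)).
Proof.
move=> sa tb; apply: red_app (red_appr _ sa) tb _.
apply: red_head; first by beta; apply: red_refl.
by beta; apply: red_refl.
Qed.

Lemma comp_pair A B {eA : encodable A} {eB : encodable B} (a : C -> A)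
    (b : C -> B) :
  computable a -> computable b -> computable (fun c => (a c, b c)).
Proof.
move=> [u cu au] [v cv bv].
exists (Lam (App (App pairT (App u (Var 0))) (App v (Var 0)))) => [|x].
  closedness.
by beta; apply: red_pair.
Qed.

Lemma comp_fst A B {eA : encodable A} {eB : encodable B} (a : C -> A * B) :
  computable a -> computable (fun c => (a c).1).
Proof.
apply: comp_comp; exists (Lam (App (Var 0) (Lam (Lam (Var 1))))) => // -[x y].
beta; rewrite enc_pair; beta; apply: red_head; first by beta; apply: red_refl.
by beta; apply: red_refl.
Qed.

Lemma comp_snd A B {eA : encodable A} {eB : encodable B} (a : C -> A * B) :
  computable a -> computable (fun c => (a c).2).
Proof.
apply: comp_comp; exists (Lam (App (Var 0) (Lam (Lam (Var 0))))) => // -[x y].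
beta; rewrite enc_pair; beta; apply: red_head; first by beta; apply: red_refl.
by beta; apply: red_refl.
Qed.

(** Both branches are evaluated before the Boolean selects one, which is safe since all functions
    involved are total. *)
Lemma comp_if A {eA : encodable A} (b : C -> bool) (x y : C -> A) :
  computable b -> computable x -> computable y ->
  computable (fun c => if b c then x c else y c).
Proof.
move=> [u cu bu] [v cv xv] [w cw yw].
exists (Lam (App (App (App u (Var 0)) (App v (Var 0))) (App w (Var 0))))
  => [|c].
  closedness.
beta; apply: red_app; [apply: red_app (bu c) (xv c) (red_refl _)|exact: yw|].
by case: (b c); (apply: red_head; first by beta; apply: red_refl);
  beta; apply: red_refl.
Qed.

Lemma comp_succ (n : C -> nat) : computable n -> computable (fun c => (n c).+1).
Proof.
apply: comp_comp; exists (Lam (Lam (Lam (App (Var 0) (Var 2))))) => // n'.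
by beta; rewrite enc_natS; apply: red_refl.
Qed.

Lemma comp_cons A {eA : encodable A} (a : C -> A) (s : C -> seq A) :
  computable a -> computable s -> computable (fun c => a c :: s c).
Proof.
move=> [u cu au] [v cv sv].
pose t := Lam (Lam (Lam (Lam (App (App (Var 0) (Var 3)) (Var 2))))).
exists (Lam (App (App t (App u (Var 0))) (App v (Var 0)))) => [|c].
  closedness.
beta; apply: red_app; [apply: red_appr (au c)|exact: sv|].
apply: red_head; first by beta; apply: red_refl.
by beta; rewrite enc_cons; apply: red_refl.
Qed.

Lemma comp_iter A {eA : encodable A} (n : C -> nat) (f : C -> A -> A)
    (z : C -> A) :
  computable n -> computable (fun p : C * A => f p.1 p.2) -> computable z ->
  computable (fun c => iter (n c) (f c) (z c)).
Proof.
move=> [un cn nu] [uf cf fu] [uz cz zu].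
(* Recursion by self-application: [d] takes itself, [c] and [n], and matches on the Scott numeral
   [n]. The recursive call sits under the abstraction of the successor branch, so it is not unfolded
   before a predecessor arrives. *)
pose b := App (App (Var 0) (App uz (Var 1)))
  (Lam (App uf (App (App pairT (Var 2))
    (App (App (App (Var 3) (Var 3)) (Var 2)) (Var 0))))).
(* Hiding the body behind an equation keeps [d] folded under simplification; rewriting with [Ed]
   unfolds one copy per round. *)
have [d Ed] : exists d, d = Lam (Lam (Lam b)) by exists (Lam (Lam (Lam b))).
have vd : value d by rewrite Ed; closedness.
have cd : closed_at 0 d := value_closed vd.
exists (Lam (App (App (App d d) (Var 0)) (App un (Var 0)))) => [|c].
  closedness.
beta; apply: red_app (red_refl _) (nu c) _.
elim: (n c) => [|m IH].
  apply: red_head.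
    apply: red_head; first by rewrite {1}Ed; beta; apply: red_refl.
    by beta; apply: red_refl.
  beta; apply: red_app; [apply: red_appr (zu c)|exact: red_refl|].
  apply: red_head; first by beta; apply: red_refl.
  by beta; apply: red_refl.
apply: red_head.
  apply: red_head; first by rewrite {1}Ed; beta; apply: red_refl.
  by beta; apply: red_refl.
beta; apply: red_app; [apply: red_appr (zu c)|exact: red_refl|].
rewrite enc_natS; apply: red_head; first by beta; apply: red_refl.
beta; beta; apply: red_app (red_refl _) (red_pair (red_refl _) IH) _.
exact: fu (c, _).
Qed.

Lemma comp_foldr A B {eA : encodable A} {eB : encodable B}
    (f : C -> A -> B -> B) (z : C -> B) (l : C -> seq A) :
  computable (fun p : C * A * B => f p.1.1 p.1.2 p.2) ->
  computable z -> computable l ->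
  computable (fun c => foldr (f c) (z c) (l c)).
Proof.
move=> [uf cf fu] [uz cz zu] [ul cl lu].
pose b := App (App (Var 0) (App uz (Var 1)))
  (Lam (Lam (App uf (App (App pairT (App (App pairT (Var 3)) (Var 1)))
    (App (App (App (Var 4) (Var 4)) (Var 3)) (Var 0)))))).
have [d Ed] : exists d, d = Lam (Lam (Lam b)) by exists (Lam (Lam (Lam b))).
have vd : value d by rewrite Ed; closedness.
have cd : closed_at 0 d := value_closed vd.
exists (Lam (App (App (App d d) (Var 0)) (App ul (Var 0)))) => [|c].
  closedness.
beta; apply: red_app (red_refl _) (lu c) _.
elim: (l c) => [|a s IH].
  apply: red_head.
    apply: red_head; first by rewrite {1}Ed; beta; apply: red_refl.
    by beta; apply: red_refl.
  beta; apply: red_app; [apply: red_appr (zu c)|exact: red_refl|].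
  apply: red_head; first by beta; apply: red_refl.
  by beta; apply: red_refl.
apply: red_head.
  apply: red_head; first by rewrite {1}Ed; beta; apply: red_refl.
  by beta; apply: red_refl.
beta; apply: red_app; [apply: red_appr (zu c)|exact: red_refl|].
rewrite enc_cons; apply: red_head; first by beta; apply: red_refl.
beta; apply: red_head; first by beta; apply: red_refl.
beta; apply: red_app (red_refl _) _ _.
  exact: red_pair (red_pair (red_refl _) (red_refl _)) IH.
exact: fu (c, a, _).
Qed.

Lemma red_foldl s s' args :
  reduces s s' -> reduces (foldl App s args) (foldl App s' args).
Proof. by elim: args s s' => //= t args IH s s' rs; apply/IH/red_appl. Qed.

Lemma subst_lams m t k u :
  subst (iter m Lam t) k u = iter m Lam (subst t (m + k) u).
Proof. by elim: m k => //= m IH k; rewrite IH addnS. Qed.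

Lemma red_lams t args :
  closed_at 0 t -> all value args ->
  reduces (foldl App (iter (size args) Lam t) args) t.
Proof.
move=> ct; elim: args => [_|v args IH] /=; first exact: red_refl.
case/andP=> vv vargs; apply: red_trans (IH vargs); apply: red_foldl.
by apply: red_betaV => //; rewrite subst_lams subst_closed //; apply: red_refl.
Qed.

Definition sel (n k : nat) : term := iter n Lam (Var (n - k.+1)).

Lemma red_sel args k : all value args -> k < size args ->
  reduces (App (enc_tuple args) (sel (size args) k)) (nth (Var 0) args k).
Proof.
move=> vargs lt_k.
have vs : value (sel (size args) k).
  rewrite /value /sel; apply/andP; split; last by case: (size args) lt_k.
  have: size args - k.+1 < 0 + size args 
    by rewrite add0n ltn_subrL; apply: leq_trans (ltn0Sn k) lt_k.
  (* Generalised over the index and over the number of binders already crossed. *)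
  elim: (size args) 0 {lt_k}(_ - _) => [|m IH] l j; first by rewrite addn0.
  by rewrite addnS -addSn => /IH.
apply: red_betaV => //.
have -> t : subst (foldl App t args) 0 (sel (size args) k)
    = foldl App (subst t 0 (sel (size args) k)) args.
  elim: args vargs {lt_k vs} (sel _ k) t => //= v args IH /andP[vv vargs] u t.
  by rewrite IH //= (subst_closed _ _ (value_closed vv)).
rewrite /= {vs} /sel; elim: args k vargs lt_k => [|v args IH] [|k] //=.
  case/andP=> vv vargs _; rewrite subn1 /=.
  apply: red_trans (red_lams (value_closed vv) vargs); apply: red_foldl.
  apply: red_betaV => //; rewrite subst_lams addn0 /= eqxx; exact: red_refl.
case/andP=> vv vargs lt_k; apply: red_trans (IH _ vargs lt_k).
apply: red_foldl; apply: red_betaV => //; rewrite subst_lams addn0 /= subSS.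
have lt_s : size args - k.+1 < size args 
  by rewrite ltn_subrL; apply: leq_trans (ltn0Sn k) lt_k.
by rewrite (ltn_eqF lt_s); apply: red_refl.
Qed.

(** Serves the projections of all three record types: only the shape of the code matters, a tuple
    with the field at position [k]. *)
Lemma comp_sel A B {eA : encodable A} {eB : encodable B} (args : A -> seq term)
    (n k : nat) (f : A -> B) (a : C -> A) :
  (forall x, enc x = enc_tuple (args x)) ->
  (forall x, all value (args x)) -> (forall x, size (args x) = n) -> k < n ->
  (forall x, nth (Var 0) (args x) k = enc (f x)) ->
  computable a -> computable (fun c => f (a c)).
Proof.
move=> encE vargs sz lt_kn nthE; apply: comp_comp.
have cs : closed_at 0 (sel n k).
  rewrite /sel.
  have: n - k.+1 < 0 + n 
    by rewrite add0n ltn_subrL; apply: leq_trans (ltn0Sn k) lt_kn.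
  elim: {lt_kn sz}n 0 (_ - _) => [|m IH] l j; first by rewrite addn0.
  by rewrite addnS -addSn => /IH.
exists (Lam (App (Var 0) (sel n k))) => [|x]; first closedness.
beta; rewrite encE -nthE -(sz x); apply: red_sel; rewrite ?vargs ?sz //.
Qed.

End Closure.

(** * First-order data *)

(** Copies of [atom] and [form] with numbers for propositions, agents and levels. They do not depend
    on [Phi], [I] or [N], so a single program can handle all instances. *)
Inductive ratom := RPrp of nat | RLt of nat & nat | REq of nat & nat.

Inductive rform :=
| RTop
| RAt of ratom
| RNeg of rform
| RAnd of rform & rform
| RK of nat & rform.

Definition enc_ratom (a : ratom) : term :=
  match a with
  | RPrp p => scott 3 0 [:: enc p]
  | RLt i n => scott 3 1 [:: enc i; enc n]
  | REq i n => scott 3 2 [:: enc i; enc n]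
  end.

Lemma enc_ratom_value a : value (enc_ratom a).
Proof. by case: a => [p|i n|i n]; rewrite /value /= ?enc_closed. Qed.

Instance encodable_ratom : encodable ratom := Encodable enc_ratom_value.

Fixpoint enc_rform (phi : rform) : term :=
  match phi with
  | RTop => scott 5 0 [::]
  | RAt a => scott 5 1 [:: enc a]
  | RNeg psi => scott 5 2 [:: enc_rform psi]
  | RAnd psi chi => scott 5 3 [:: enc_rform psi; enc_rform chi]
  | RK i psi => scott 5 4 [:: enc i; enc_rform psi]
  end.

Lemma enc_rform_value phi : value (enc_rform phi).
Proof.
have closedW t : value t -> closed_at 5 t by move=> /value_closed/closed0.
elim: phi => [|a|psi /closedW cpsi|psi /closedW cpsi chi /closedW cchi
  |i psi /closedW cpsi]; by rewrite /value /= ?cpsi ?cchi ?enc_closed.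
Qed.

Instance encodable_rform : encodable rform := Encodable enc_rform_value.

(** All recursion on formulas in the procedure goes through this fold, so that its computability has
    to be shown only once. *)
Fixpoint rform_fold A (top : A) (at_ : ratom -> A) (neg : A -> A)
    (and : A -> A -> A) (k : nat -> A -> A) (phi : rform) : A :=
  let fold := rform_fold top at_ neg and k in
  match phi with
  | RTop => top
  | RAt a => at_ a
  | RNeg psi => neg (fold psi)
  | RAnd psi chi => and (fold psi) (fold chi)
  | RK i psi => k i (fold psi)
  end.

Ltac head_normal :=
  first [ beta; apply: red_refl
        | apply: red_head; [head_normal | by beta; apply: red_refl] ].

Ltac branch := first [ beta | apply: red_head; [head_normal |]; beta ].

Record rstate := RState {
  racc : seq (seq (seq bool));
  rval : seq (nat * seq bool);
  ratt : seq (seq nat);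
  ractual : nat
}.

Record raction := RAction {
  rdep : seq (seq (seq bool));
  rqdep : seq (seq (seq bool));
  rpre : seq rform;
  rcost : seq (seq nat);
  rquestion : seq rform;
  revent : nat
}.

Record rtask := RTask {
  ragents : nat;
  rbound : nat;
  rinit : rstate;
  ractions : seq raction;
  rgoal : rform
}.

Definition rstate_args r :=
  [:: enc (racc r); enc (rval r); enc (ratt r); enc (ractual r)].

Definition raction_args r :=
  [:: enc (rdep r); enc (rqdep r); enc (rpre r); enc (rcost r);
      enc (rquestion r); enc (revent r)].

Lemma rstate_args_value r : all value (rstate_args r).
Proof. by rewrite /= !enc_value. Qed.

Lemma raction_args_value r : all value (raction_args r).
Proof. by rewrite /= !enc_value. Qed.

Lemma enc_tuple_value args : all value args -> value (enc_tuple args).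
Proof.
rewrite /enc_tuple /scott /value /= andbT.
elim: args (Var 0) (erefl : closed_at 1 (Var 0)) => //= v args IH t ct.
by case/andP=> /value_closed/(closed0 1) cv; apply: IH; rewrite /= ct cv.
Qed.

Instance encodable_rstate : encodable rstate :=
  Encodable (fun r => enc_tuple_value (rstate_args_value r)).

Instance encodable_raction : encodable raction :=
  Encodable (fun r => enc_tuple_value (raction_args_value r)).

Definition rtask_args r :=
  [:: enc (ragents r); enc (rbound r); enc (rinit r); enc (ractions r);
      enc (rgoal r)].

Lemma rtask_args_value r : all value (rtask_args r).
Proof. by rewrite /= !enc_value. Qed.

Instance encodable_rtask : encodable rtask :=
  Encodable (fun r => enc_tuple_value (rtask_args_value r)).

(** * Recursion and projections on first-order data *)

Section DataClosure.
Context (C : Type) {eC : encodable C}.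

Lemma comp_ratom_case A {eA : encodable A} (a : C -> ratom) (f : C -> nat -> A)
    (g h : C -> nat -> nat -> A) :
  computable a -> computable (fun p : C * nat => f p.1 p.2) ->
  computable (fun p : C * nat * nat => g p.1.1 p.1.2 p.2) ->
  computable (fun p : C * nat * nat => h p.1.1 p.1.2 p.2) ->
  computable (fun c => match a c with
                 | RPrp p => f c p
                 | RLt i n => g c i n
                 | REq i n => h c i n
                 end).
Proof.
move=> [ua ca au] [uf cf fu] [ug cg gu] [uh ch hu].
pose t2 u := Lam (Lam (App u (App (App pairT (App (App pairT (Var 2)) (Var 1)))
  (Var 0)))).
exists (Lam (App (App (App (App ua (Var 0))
  (Lam (App uf (App (App pairT (Var 1)) (Var 0))))) (t2 ug)) (t2 uh))) => [|c].
  closedness.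
beta; apply: red_head.
  apply: red_head; first by apply: red_head; [exact: au|exact: red_refl].
  exact: red_refl.
have encE x : enc x = enc_ratom x by [].
case: (a c) => [p|i n|i n]; rewrite encE /= /t2.
- branch; branch.
  exact: red_app (red_refl _) (red_pair (red_refl _) (red_refl _)) (fu (_, _)).
- branch; branch.
  apply: red_app (red_refl _) _ (gu (_, _, _)).
  exact: red_pair (red_pair (red_refl _) (red_refl _)) (red_refl _).
- branch; branch.
  apply: red_app (red_refl _) _ (hu (_, _, _)).
  exact: red_pair (red_pair (red_refl _) (red_refl _)) (red_refl _).
Qed.

Lemma comp_rform_fold A {eA : encodable A} (top : C -> A)
    (at_ : C -> ratom -> A) (neg : C -> A -> A) (and : C -> A -> A -> A)
    (k : C -> nat -> A -> A)
    (phi : C -> rform) :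
  computable top -> computable (fun p : C * ratom => at_ p.1 p.2) ->
  computable (fun p : C * A => neg p.1 p.2) ->
  computable (fun p : C * A * A => and p.1.1 p.1.2 p.2) ->
  computable (fun p : C * nat * A => k p.1.1 p.1.2 p.2) -> computable phi ->
  computable (fun c =>
    rform_fold (top c) (at_ c) (neg c) (and c) (k c) (phi c)).
Proof.
move=> [ut ct tu] [ua ca au] [un cn nu] [ud cd du] [uk ck ku] [up cp pu].
(* The recursive call, here under the two binders of the branches for [RAnd] and [RK]; [rec1] is the
   same call under the single binder of [RNeg]. *)
pose rec x := App (App (App (Var 4) (Var 4)) (Var 3)) (Var x).
pose rec1 x := App (App (App (Var 3) (Var 3)) (Var 2)) (Var x).
pose b := App (App (App (App (App (Var 0) (App ut (Var 1)))
  (Lam (App ua (App (App pairT (Var 2)) (Var 0)))))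
  (Lam (App un (App (App pairT (Var 2)) (rec1 0)))))
  (Lam (Lam (App ud (App (App pairT (App (App pairT (Var 3)) (rec 1)))
                      (rec 0))))))
  (Lam (Lam (App uk (App (App pairT (App (App pairT (Var 3)) (Var 1)))
                      (rec 0))))).
have [d Ed] : exists d, d = Lam (Lam (Lam b)) by exists (Lam (Lam (Lam b))).
have vd : value d by rewrite Ed; closedness.
have cld : closed_at 0 d := value_closed vd.
exists (Lam (App (App (App d d) (Var 0)) (App up (Var 0)))) => [|c].
  closedness.
beta; apply: red_app (red_refl _) (pu c) _.
have encE x : enc x = enc_rform x by [].
have unroll phi' r :
    reduces (App (App (App (App (App (enc_rform phi') (enc (top c)))
      (Lam (App ua (App (App pairT (enc c)) (Var 0)))))
      (Lam (App un (App (App pairT (enc c))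
        (App (App (App d d) (enc c)) (Var 0))))))
      (Lam (Lam (App ud (App (App pairT (App (App pairT (enc c))
        (App (App (App d d) (enc c)) (Var 1))))
        (App (App (App d d) (enc c)) (Var 0)))))))
      (Lam (Lam (App uk (App (App pairT (App (App pairT (enc c)) (Var 1)))
        (App (App (App d d) (enc c)) (Var 0))))))) r ->
    reduces (App (App (App d d) (enc c)) (enc phi')) r.
  move=> red; apply: red_head.
    apply: red_head; first by rewrite {1}Ed; beta; apply: red_refl.
    by beta; apply: red_refl.
  beta; apply: red_trans red; rewrite encE.
  by do 4 apply: red_appl; apply: red_appr; apply: tu.
elim: (phi c) => [|a|psi IH|psi IHpsi chi IHchi|i psi IH]; apply: unroll => /=.
- by branch; apply: red_refl.
- branch; branch.
  exact: red_app (red_refl _) (red_pair (red_refl _) (red_refl _)) (au (_, _)).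
- rewrite -!encE; branch; branch.
  exact: red_app (red_refl _) (red_pair (red_refl _) IH) (nu (_, _)).
- rewrite -!encE; branch; branch.
  apply: red_app (red_refl _) _ (du (_, _, _)).
  exact: red_pair (red_pair (red_refl _) IHpsi) IHchi.
- rewrite -!encE; branch; branch.
  apply: red_app (red_refl _) _ (ku (_, _, _)).
  exact: red_pair (red_pair (red_refl _) (red_refl _)) IH.
Qed.

Lemma comp_RState (acc : C -> seq (seq (seq bool)))
    (val : C -> seq (nat * seq bool)) (att : C -> seq (seq nat))
    (w : C -> nat) :
  computable acc -> computable val -> computable att -> computable w ->
  computable (fun c => RState (acc c) (val c) (att c) (w c)).
Proof.
move=> [u1 c1 r1] [u2 c2 r2] [u3 c3 r3] [u4 c4 r4].
pose t := Lam (Lam (Lam (Lam (Lam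
  (App (App (App (App (Var 0) (Var 4)) (Var 3)) (Var 2)) (Var 1)))))).
exists (Lam (App (App (App (App t (App u1 (Var 0))) (App u2 (Var 0)))
  (App u3 (Var 0))) (App u4 (Var 0)))) => [|c].
  closedness.
beta; apply: red_app (r4 c) _.
  apply: red_app (r3 c) (red_refl _).
  apply: red_app (r2 c) (red_refl _).
  apply: red_appr (r1 c).
by rewrite /t; branch; apply: red_refl.
Qed.

Ltac projection n k args args_value :=
  by move=> ?; apply: (comp_sel (args := args) (n := n) (k := k));
    try exact: args_value.

Lemma comp_racc (r : C -> rstate) :
  computable r -> computable (fun c => racc (r c)).
Proof. projection 4 0 rstate_args rstate_args_value. Qed.

Lemma comp_rval (r : C -> rstate) :
  computable r -> computable (fun c => rval (r c)).
Proof. projection 4 1 rstate_args rstate_args_value. Qed.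

Lemma comp_ratt (r : C -> rstate) :
  computable r -> computable (fun c => ratt (r c)).
Proof. projection 4 2 rstate_args rstate_args_value. Qed.

Lemma comp_ractual (r : C -> rstate) :
  computable r -> computable (fun c => ractual (r c)).
Proof. projection 4 3 rstate_args rstate_args_value. Qed.

Lemma comp_rdep (r : C -> raction) :
  computable r -> computable (fun c => rdep (r c)).
Proof. projection 6 0 raction_args raction_args_value. Qed.

Lemma comp_rqdep (r : C -> raction) :
  computable r -> computable (fun c => rqdep (r c)).
Proof. projection 6 1 raction_args raction_args_value. Qed.

Lemma comp_rpre (r : C -> raction) :
  computable r -> computable (fun c => rpre (r c)).
Proof. projection 6 2 raction_args raction_args_value. Qed.

Lemma comp_rcost (r : C -> raction) :
  computable r -> computable (fun c => rcost (r c)).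
Proof. projection 6 3 raction_args raction_args_value. Qed.

Lemma comp_rquestion (r : C -> raction) :
  computable r -> computable (fun c => rquestion (r c)).
Proof. projection 6 4 raction_args raction_args_value. Qed.

Lemma comp_revent (r : C -> raction) :
  computable r -> computable (fun c => revent (r c)).
Proof. projection 6 5 raction_args raction_args_value. Qed.

Lemma comp_ragents (r : C -> rtask) :
  computable r -> computable (fun c => ragents (r c)).
Proof. projection 5 0 rtask_args rtask_args_value. Qed.

Lemma comp_rbound (r : C -> rtask) :
  computable r -> computable (fun c => rbound (r c)).
Proof. projection 5 1 rtask_args rtask_args_value. Qed.

Lemma comp_rinit (r : C -> rtask) :
  computable r -> computable (fun c => rinit (r c)).
Proof. projection 5 2 rtask_args rtask_args_value. Qed.

Lemma comp_ractions (r : C -> rtask) :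
  computable r -> computable (fun c => ractions (r c)).
Proof. projection 5 3 rtask_args rtask_args_value. Qed.

Lemma comp_rgoal (r : C -> rtask) :
  computable r -> computable (fun c => rgoal (r c)).
Proof. projection 5 4 rtask_args rtask_args_value. Qed.

End DataClosure.

Lemma comp_app2 C A B D {eC : encodable C} {eA : encodable A}
    {eB : encodable B} {eD : encodable D} (f : A -> B -> D) (a : C -> A)
    (b : C -> B) :
  computable (fun p : A * B => f p.1 p.2) -> computable a -> computable b ->
  computable (fun c => f (a c) (b c)).
Proof.
move=> cf ca cb; apply: (comp_comp (a := fun c => (a c, b c)) cf).
exact: comp_pair.
Qed.

Ltac eta_expand :=
  try lazymatch goal with
  | |- computable (fun _ => _) => idtac
  | |- @computable ?A _ _ _ ?f => change (computable (fun x : A => f x))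
  end.

(* Surjective pairing would let [comp_pair] apply to any function into a
   product, hence the syntactic guards. *)
Ltac comp_with tac :=
  repeat (lazy beta; eta_expand;
    first [ assumption | apply: comp_const | apply: comp_id
          | lazymatch goal with
            | |- computable (fun _ => (_, _)) => apply: comp_pair
            | |- computable (fun _ => _.1) => apply: comp_fst
            | |- computable (fun _ => _.2) => apply: comp_snd
            | |- computable (fun _ => _ :: _) => apply: comp_cons
            | |- computable (fun _ => _.+1) => apply: comp_succ
            | |- computable (fun _ => iter _ _ _) => apply: comp_iter
            | |- computable (fun _ => foldr _ _ _) => apply: comp_foldr
            | |- computable (fun _ => if _ then _ else _) => apply: comp_if
            end
          | tac
          | match goal with
            | H : computable ?f |- computable (fun x => ?f (@?a x)) =>
              apply: (comp_comp H)
            | H : computable (fun p => ?f p.1 p.2)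
              |- computable (fun x => ?f (@?a x) (@?b x)) =>
              apply: (comp_app2 H)
            end ]).

(** * Arithmetic and Boolean operations *)

Lemma comp_addn C {eC : encodable C} (m n : C -> nat) :
  computable m -> computable n ->
  computable (fun c => m c + n c).
Proof.
move=> cm cn; apply: (comp_ext (f := fun c => iter (m c) S (n c))).
  by move=> c; elim: (m c) => //= k ->.
by comp_with fail.
Qed.

(** Kleene's predecessor: iteration does not expose its counter, so the pair of the predecessor and
    the number itself is carried along. *)
Lemma comp_predn C {eC : encodable C} (n : C -> nat) :
  computable n -> computable (fun c => (n c).-1).
Proof.
move=> cn.
apply: (comp_ext
  (f := fun c => (iter (n c) (fun p => (p.2, p.2.+1)) (0, 0)).1)).
  move=> c; suff -> : iter (n c) (fun p => (p.2, p.2.+1)) (0, 0)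
    = ((n c).-1, n c) by [].
  by elim: (n c) => //= k ->.
by comp_with fail.
Qed.

Lemma comp_subn C {eC : encodable C} (m n : C -> nat) :
  computable m -> computable n ->
  computable (fun c => m c - n c).
Proof.
move=> cm cn; apply: (comp_ext (f := fun c => iter (n c) predn (m c))).
  by move=> c; elim: (n c) => [|k /= ->]; rewrite ?subn0 ?subnS.
by comp_with ltac:(apply: comp_predn).
Qed.

Lemma comp_muln C {eC : encodable C} (m n : C -> nat) :
  computable m -> computable n ->
  computable (fun c => m c * n c).
Proof.
move=> cm cn; apply: (comp_ext (f := fun c => iter (m c) (addn (n c)) 0)).
  by move=> c; elim: (m c) => //= k ->; rewrite mulSn.
by comp_with ltac:(apply: comp_addn).
Qed.

Lemma comp_expn C {eC : encodable C} (m n : C -> nat) :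
  computable m -> computable n ->
  computable (fun c => m c ^ n c).
Proof.
move=> cm cn; apply: (comp_ext (f := fun c => iter (n c) (muln (m c)) 1)).
  by move=> c; elim: (n c) => //= k ->; rewrite expnS.
by comp_with ltac:(apply: comp_muln).
Qed.

Lemma comp_leq C {eC : encodable C} (m n : C -> nat) :
  computable m -> computable n ->
  computable (fun c => m c <= n c).
Proof.
move=> cm cn.
apply: (comp_ext (f := fun c => iter (m c - n c) (fun _ => false) true)).
  by move=> c; rewrite /leq; case: (_ - _).
by comp_with ltac:(apply: comp_subn).
Qed.

Lemma comp_eqn C {eC : encodable C} (m n : C -> nat) :
  computable m -> computable n ->
  computable (fun c => m c == n c).
Proof.
move=> cm cn.
apply: (comp_ext (f := fun c => if m c <= n c then n c <= m c else false)).
  by move=> c; rewrite eqn_leq; case: (_ <= _).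
by comp_with ltac:(apply: comp_leq).
Qed.

Lemma comp_andb C {eC : encodable C} (a b : C -> bool) :
  computable a -> computable b -> computable (fun c => a c && b c).
Proof. by move=> ca cb; rewrite /andb; comp_with fail. Qed.

Lemma comp_orb C {eC : encodable C} (a b : C -> bool) :
  computable a -> computable b -> computable (fun c => a c || b c).
Proof. by move=> ca cb; rewrite /orb; comp_with fail. Qed.

Lemma comp_negb C {eC : encodable C} (a : C -> bool) :
  computable a -> computable (fun c => ~~ a c).
Proof. by move=> ca; rewrite /negb; comp_with fail. Qed.

Lemma comp_implb C {eC : encodable C} (a b : C -> bool) :
  computable a -> computable b -> computable (fun c => a c ==> b c).
Proof. by move=> ca cb; rewrite /implb; comp_with fail. Qed.

Lemma comp_eqb C {eC : encodable C} (a b : C -> bool) :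
  computable a -> computable b -> computable (fun c => a c == b c).
Proof.
move=> ca cb; apply: (comp_ext (f := fun c => if a c then b c else ~~ b c)).
  by move=> c; case: (a c); case: (b c).
by comp_with ltac:(apply: comp_negb).
Qed.

Ltac comp_arith := idtac;
  lazymatch goal with
  | |- computable (fun _ => _ + _) => apply: comp_addn
  | |- computable (fun _ => _ - _) => apply: comp_subn
  | |- computable (fun _ => _ * _) => apply: comp_muln
  | |- computable (fun _ => _ ^ _) => apply: comp_expn
  | |- computable (fun _ => _ <= _) => apply: comp_leq
  | |- computable (fun _ => _ && _) => apply: comp_andb
  | |- computable (fun _ => _ || _) => apply: comp_orb
  | |- computable (fun _ => ~~ _) => apply: comp_negb
  | |- computable (fun _ => _ ==> _) => apply: comp_implb
  | |- computable (fun _ => @eq_op _ _ _) =>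
    first [apply: comp_eqn | apply: comp_eqb]
  end.

(** * Operations on lists *)

Section Lists.
Context (C A : Type) {eC : encodable C} {eA : encodable A}.

Lemma comp_cat (s t : C -> seq A) : computable s -> computable t ->
  computable (fun c => s c ++ t c).
Proof.
move=> cs ct; apply: (comp_ext (f := fun c => foldr cons (t c) (s c))).
  by move=> c; elim: (s c) => //= a l ->.
by comp_with fail.
Qed.

Lemma comp_map B {eB : encodable B} (f : C -> A -> B) (s : C -> seq A) :
  computable (fun p : C * A => f p.1 p.2) -> computable s ->
  computable (fun c => map (f c) (s c)).
Proof.
move=> cf cs.
apply: (comp_ext (f := fun c => foldr (fun a t => f c a :: t) [::] (s c))).
  by [].
by comp_with fail.
Qed.

Lemma comp_filter (f : C -> A -> bool) (s : C -> seq A) :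
  computable (fun p : C * A => f p.1 p.2) -> computable s ->
  computable (fun c => filter (f c) (s c)).
Proof.
move=> cf cs; apply: (comp_ext
  (f := fun c => foldr (fun a t => if f c a then a :: t else t) [::] (s c))).
  by [].
by comp_with fail.
Qed.

Lemma comp_all (f : C -> A -> bool) (s : C -> seq A) :
  computable (fun p : C * A => f p.1 p.2) -> computable s ->
  computable (fun c => all (f c) (s c)).
Proof.
move=> cf cs.
apply: (comp_ext (f := fun c => foldr (fun a t => f c a && t) true (s c))).
  by [].
by comp_with comp_arith.
Qed.

Lemma comp_has (f : C -> A -> bool) (s : C -> seq A) :
  computable (fun p : C * A => f p.1 p.2) -> computable s ->
  computable (fun c => has (f c) (s c)).
Proof.
move=> cf cs.
apply: (comp_ext (f := fun c => foldr (fun a t => f c a || t) false (s c))).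
  by [].
by comp_with comp_arith.
Qed.

Lemma comp_size (s : C -> seq A) :
  computable s -> computable (fun c => size (s c)).
Proof.
move=> cs.
apply: (comp_ext (f := fun c => foldr (fun _ n => n.+1) 0 (s c))); first by [].
by comp_with fail.
Qed.

Lemma comp_head (x : C -> A) (s : C -> seq A) : computable x -> computable s ->
  computable (fun c => head (x c) (s c)).
Proof.
move=> cx cs.
apply: (comp_ext (f := fun c => foldr (fun a _ => a) (x c) (s c))).
  by move=> c; case: (s c).
by comp_with fail.
Qed.

Lemma comp_behead (s : C -> seq A) :
  computable s -> computable (fun c => behead (s c)).
Proof.
move=> cs; apply: (comp_ext (f := fun c =>
  (foldr (fun a p => (p.2, a :: p.2)) ([::], [::]) (s c)).1)).
  move=> c; suff -> : foldr (fun a p => (p.2, a :: p.2)) ([::], [::]) (s c)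
    = (behead (s c), s c) by [].
  by elim: (s c) => //= a t ->.
by comp_with fail.
Qed.
End Lists.

Lemma comp_nth C A {eC : encodable C} {eA : encodable A} (x : C -> A)
    (s : C -> seq A) (n : C -> nat) :
  computable x -> computable s -> computable n ->
  computable (fun c => nth (x c) (s c) (n c)).
Proof.
move=> cx cs cn.
apply: (comp_ext (f := fun c => head (x c) (iter (n c) behead (s c)))).
  move=> c; elim: (n c) (s c) => [|k IH] t; first by rewrite nth0.
  by rewrite iterSr IH nth_behead.
by comp_with ltac:(first [apply: comp_head | apply: comp_behead]).
Qed.

Lemma comp_flatten C A {eC : encodable C} {eA : encodable A}
    (s : C -> seq (seq A)) :
  computable s -> computable (fun c => flatten (s c)).
Proof.
move=> cs; apply: (comp_ext (f := fun c => foldr cat [::] (s c))); first by [].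
by comp_with ltac:(apply: comp_cat).
Qed.

Lemma comp_iota0 C {eC : encodable C} (n : C -> nat) :
  computable n -> computable (fun c => iota 0 (n c)).
Proof.
move=> cn.
apply: (comp_ext (f := fun c => iter (n c) (fun s => 0 :: map S s) [::])).
  by move=> c; elim: (n c) => //= k ->; rewrite (iotaDl 1 0).
by comp_with ltac:(apply: comp_map).
Qed.

Ltac comp_seq := idtac;
  lazymatch goal with
  | |- computable (fun _ => _ ++ _) => apply: comp_cat
  | |- computable (fun _ => map _ _) => apply: comp_map
  | |- computable (fun _ => filter _ _) => apply: comp_filter
  | |- computable (fun _ => all _ _) => apply: comp_all
  | |- computable (fun _ => has _ _) => apply: comp_has
  | |- computable (fun _ => size _) => apply: comp_size
  | |- computable (fun _ => head _ _) => apply: comp_head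
  | |- computable (fun _ => behead _) => apply: comp_behead
  | |- computable (fun _ => nth _ _ _) => apply: comp_nth
  | |- computable (fun _ => flatten _) => apply: comp_flatten
  | |- computable (fun _ => iota 0 _) => apply: comp_iota0
  end.

Lemma comp_index_nat C {eC : encodable C} (n : C -> nat) (s : C -> seq nat) :
  computable n -> computable s -> computable (fun c => index (n c) (s c)).
Proof.
move=> cn cs; apply: (comp_ext (f := fun c =>
  foldr (fun a k => if a == n c then 0 else k.+1) 0 (s c))).
  by move=> c; elim: (s c) => //= a t ->.
by comp_with comp_arith.
Qed.

(** * The decision procedure *)

Definition entry2 (m : seq (seq nat)) i x := nth 0 (nth [::] m i) x.

Definition entry3 (m : seq (seq (seq bool))) i x y :=
  nth false (nth [::] (nth [::] m i) x) y.

(** The code of a state has no field for the number of worlds; it is read off the relation of the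
    first agent, which exists because there are agents. *)
Definition nworlds (r : rstate) : nat := size (head [::] (racc r)).

Definition rval_of (r : rstate) (p : nat) : seq bool :=
  foldr (fun pv t => if pv.1 == p then pv.2 else t) [::] (rval r).

(** Whole vectors of truth values are computed, because the clause for [RK] consults other
    worlds. *)
Definition truth (r : rstate) (phi : rform) : seq bool :=
  let worlds := iota 0 (nworlds r) in
  rform_fold
    [seq true | _ <- worlds]
    (fun a => match a with
              | RPrp p => rval_of r p
              | RLt i n => [seq k < n | k <- nth [::] (ratt r) i]
              | REq i n => [seq k == n | k <- nth [::] (ratt r) i]
              end)
    (map negb)
    (fun s t => [seq nth false s w && nth false t w | w <- worlds])
    (fun i s =>
      [seq all (fun v => entry3 (racc r) i w v ==> nth false s v) worlds
      | w <- worlds])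
    phi.

Definition rholds (r : rstate) (phi : rform) : bool :=
  nth false (truth r phi) (ractual r).

Definition rprops : rform -> seq nat :=
  rform_fold [::]
    (fun a => match a with
              | RPrp p => [:: p] | RLt _ _ => [::] | REq _ _ => [::]
              end)
    id cat (fun _ s => s).

Definition rboxes : rform -> seq nat :=
  rform_fold [::] (fun _ => [::]) id cat cons.

Definition tuples A (s : seq A) (n : nat) : seq (seq A) :=
  iter n (fun ts => flatten [seq [seq a :: t | t <- ts] | a <- s]) [:: [::]].

Definition subseqs A (s : seq A) : seq (seq A) :=
  foldr (fun a ts => ts ++ map (cons a) ts) [:: [::]] s.

(* Truth values of the propositions, truth values of the boxed subformulas and
   attention levels of the agents at a world of a filtration. *)
Definition label : Type := (seq bool * seq bool * seq nat)%type.

Definition labels (nagents bound nprops nboxes : nat) : seq label :=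
  let bools := [:: true; false] in
  flatten [seq flatten [seq [seq (p, k, a)
                            | a <- tuples (iota 0 bound.+1) nagents]
                       | k <- tuples bools nboxes]
          | p <- tuples bools nprops].

(** The filtration suited to equivalence relations: being agreement on the level and the boxes of
    agent [i], it is an equivalence for any set of labels. *)
Definition label_rel (boxes : seq nat) (i : nat) (l l' : label) : bool :=
  (nth 0 l.2 i == nth 0 l'.2 i) &&
  all (fun j => (nth 0 boxes j == i) ==>
                (nth false l.1.2 j == nth false l'.1.2 j))
    (iota 0 (size boxes)).

(** The actual world [0] is a placeholder: [rentails] inspects every world, and passes the empty
    list. *)
Definition label_state (nagents : nat) (props boxes : seq nat)
    (s : seq label) : rstate :=
  RState
    [seq [seq [seq label_rel boxes i l l' | l' <- s] | l <- s]
    | i <- iota 0 nagents]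
    [seq (p, [seq nth false l.1.1 (index p props) | l <- s]) | p <- props]
    [seq [seq nth 0 l.2 i | l <- s] | i <- iota 0 nagents]
    0.

(** The bits recorded for boxed formulas need not agree with their truth in the tested structure.
    This does no harm: every nonempty set of labels gives some attention model, so a failure is a
    genuine counterexample, and the labels realised in a countermodel are among the sets tested. *)
Definition rentails (nagents bound : nat) (phi psi : rform) : bool :=
  let props := rprops phi ++ rprops psi in
  let boxes := rboxes phi ++ rboxes psi in
  all (fun s => let r := label_state nagents props boxes s in
         all (fun w => nth false (truth r phi) w ==> nth false (truth r psi) w)
           (iota 0 (size s)))
    (subseqs (labels nagents bound (size props) (size boxes))).

Definition rpre_of (X : raction) (e : nat) : rform := nth RTop (rpre X) e.

Definition rupdate_worlds (r : rstate) (X : raction) : seq (nat * nat) :=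
  [seq x <- flatten [seq [seq (w, e) | e <- iota 0 (size (rpre X))]
                    | w <- iota 0 (nworlds r)]
  | nth false (truth r (rpre_of X x.2)) x.1].

Definition rupdate_rel (nagents bound : nat) (r : rstate) (X : raction)
    (i : nat) (x y : nat * nat) : bool :=
  entry3 (racc r) i x.1 y.1 &&
  (entry3 (rdep X) i x.2 y.2 ||
   entry3 (rqdep X) i x.2 y.2 &&
   ((entry2 (ratt r) i x.1 < entry2 (rcost X) i x.2) ||
    (rentails nagents bound (rpre_of X x.2) (nth RTop (rquestion X) i) ==
     rentails nagents bound (rpre_of X y.2) (nth RTop (rquestion X) i)))).

Definition rupdate (nagents bound : nat) (r : rstate) (X : raction) : rstate :=
  let worlds := rupdate_worlds r X in
  let agents := iota 0 nagents in
  RState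
    [seq [seq [seq rupdate_rel nagents bound r X i x y | y <- worlds]
         | x <- worlds]
    | i <- agents]
    [seq (pv.1, [seq nth false pv.2 x.1 | x <- worlds]) | pv <- rval r]
    [seq [seq entry2 (ratt r) i x.1 - entry2 (rcost X) i x.2 | x <- worlds]
    | i <- agents]
    (foldr (fun x k => if (x.1 == ractual r) && (x.2 == revent X) then 0
                       else k.+1) 0 worlds).

Definition rapplicable (r : rstate) (X : raction) : bool :=
  rholds r (rpre_of X (revent X)).

(** Since [rs] is kept, [k] rounds cover all plans of length at most [k]. *)
Definition expand (nagents bound : nat) (actions : seq raction)
    (rs : seq rstate) : seq rstate :=
  rs ++ flatten [seq [seq rupdate nagents bound r X
                     | X <- [seq X <- actions | rapplicable r X]]
                | r <- rs].

(** At most [attention] updates are not idle, which leaves [attention.+1] phases. Up to bisimulation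
    only non-idle updates enlarge the model, so [worlds * events ^ attention] bounds its size, and
    with it the number of world-losing idle updates in a phase; the summand [1] pays for the update
    that ends the phase. *)
Definition plan_bound (events worlds attention : nat) : nat :=
  attention.+1 * (worlds * events ^ attention + 1).

(** The sum dominates the number of events of each action, and starting from [1] makes it positive,
    as [short_plan] asks. *)
Definition max_events (actions : seq raction) : nat :=
  foldr (fun X k => size (rpre X) + k) 1 actions.

Definition rtask_bound (T : rtask) : nat :=
  plan_bound (max_events (ractions T)) (nworlds (rinit T))
    (ragents T * rbound T).

Definition solvable (T : rtask) : bool :=
  has (fun r => rholds r (rgoal T))
    (iter (rtask_bound T) (expand (ragents T) (rbound T) (ractions T))
      [:: rinit T]).

Ltac comp_data :=
  first [ comp_arith | comp_seq
  | lazymatch goal with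
    | |- computable (fun _ => RState _ _ _ _) => apply: comp_RState
    | |- computable (fun _ => racc _) => apply: comp_racc
    | |- computable (fun _ => rval _) => apply: comp_rval
    | |- computable (fun _ => ratt _) => apply: comp_ratt
    | |- computable (fun _ => ractual _) => apply: comp_ractual
    | |- computable (fun _ => rdep _) => apply: comp_rdep
    | |- computable (fun _ => rqdep _) => apply: comp_rqdep
    | |- computable (fun _ => rpre _) => apply: comp_rpre
    | |- computable (fun _ => rcost _) => apply: comp_rcost
    | |- computable (fun _ => rquestion _) => apply: comp_rquestion
    | |- computable (fun _ => revent _) => apply: comp_revent
    | |- computable (fun _ => ragents _) => apply: comp_ragents
    | |- computable (fun _ => rbound _) => apply: comp_rbound
    | |- computable (fun _ => rinit _) => apply: comp_rinit
    | |- computable (fun _ => ractions _) => apply: comp_ractions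
    | |- computable (fun _ => rgoal _) => apply: comp_rgoal
    | |- computable (fun _ => rform_fold _ _ _ _ _ _) => apply: comp_rform_fold
    | |- computable (fun _ => match _ with
                              | RPrp _ => _ | RLt _ _ => _ | REq _ _ => _
                              end) => apply: comp_ratom_case
    end ].

(** * Computability of the procedure *)

Section Programs.
Context (C : Type) {eC : encodable C}.

Lemma comp_truth (r : C -> rstate) (phi : C -> rform) :
  computable r -> computable phi -> computable (fun c => truth (r c) (phi c)).
Proof.
move=> cr cphi; rewrite /truth /entry3 /nworlds /rval_of.
by comp_with comp_data.
Qed.

Lemma comp_rholds (r : C -> rstate) (phi : C -> rform) :
  computable r -> computable phi -> computable (fun c => rholds (r c) (phi c)).
Proof.
move=> cr cphi; rewrite /rholds.
by comp_with ltac:(first [apply: comp_truth | comp_data]).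
Qed.

Lemma comp_rprops (phi : C -> rform) :
  computable phi -> computable (fun c => rprops (phi c)).
Proof. by move=> cphi; rewrite /rprops; comp_with comp_data. Qed.

Lemma comp_rboxes (phi : C -> rform) :
  computable phi -> computable (fun c => rboxes (phi c)).
Proof. by move=> cphi; rewrite /rboxes; comp_with comp_data. Qed.

Lemma comp_tuples A {eA : encodable A} (s : C -> seq A) (n : C -> nat) :
  computable s -> computable n -> computable (fun c => tuples (s c) (n c)).
Proof. by move=> cs cn; rewrite /tuples; comp_with comp_data. Qed.

Lemma comp_subseqs A {eA : encodable A} (s : C -> seq A) :
  computable s -> computable (fun c => subseqs (s c)).
Proof. by move=> cs; rewrite /subseqs; comp_with comp_data. Qed.

End Programs.

Ltac comp_label :=
  first [ comp_data
  | lazymatch goal with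
    | |- computable (fun _ => truth _ _) => apply: comp_truth
    | |- computable (fun _ => rholds _ _) => apply: comp_rholds
    | |- computable (fun _ => rprops _) => apply: comp_rprops
    | |- computable (fun _ => rboxes _) => apply: comp_rboxes
    | |- computable (fun _ => tuples _ _) => apply: comp_tuples
    | |- computable (fun _ => subseqs _) => apply: comp_subseqs
    | |- computable (fun _ => index _ _) => apply: comp_index_nat
    end ].

Lemma comp_rentails C {eC : encodable C} (nagents bound : C -> nat)
    (phi psi : C -> rform) :
  computable nagents -> computable bound -> computable phi -> computable psi ->
  computable (fun c => rentails (nagents c) (bound c) (phi c) (psi c)).
Proof.
move=> cn cb cphi cpsi.
rewrite /rentails /labels /label_state /label_rel.
by comp_with comp_label.
Qed.

Ltac comp_plan :=
  first [ comp_label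
  | lazymatch goal with
    | |- computable (fun _ => rentails _ _ _ _) => apply: comp_rentails
    end ].

Lemma comp_rupdate_worlds C {eC : encodable C} (r : C -> rstate)
    (X : C -> raction) :
  computable r -> computable X ->
  computable (fun c => rupdate_worlds (r c) (X c)).
Proof.
move=> cr cX; rewrite /rupdate_worlds /rpre_of /nworlds.
by comp_with comp_label.
Qed.

Lemma comp_rupdate C {eC : encodable C} (nagents bound : C -> nat)
    (r : C -> rstate) (X : C -> raction) :
  computable nagents -> computable bound -> computable r -> computable X ->
  computable (fun c => rupdate (nagents c) (bound c) (r c) (X c)).
Proof.
move=> cn cb cr cX; rewrite /rupdate /rupdate_rel /rpre_of /entry3 /entry2.
by comp_with ltac:(first [apply: comp_rupdate_worlds | comp_plan]).
Qed.

Lemma comp_solvable : computable solvable.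
Proof.
rewrite /solvable /rtask_bound /plan_bound /max_events /expand /rapplicable
  /rpre_of /nworlds.
by comp_with ltac:(first [comp_plan | apply: comp_rupdate]).
Qed.

(** * Correctness of the data representation *)

Lemma map_index_iota (T : eqType) (s : seq T) :
  uniq s -> [seq index x s | x <- s] = iota 0 (size s).
Proof.
case: s => // x0 s us; apply: (@eq_from_nth _ 0).
  by rewrite size_map size_iota.
rewrite size_map.
move=> k lt_k; rewrite (nth_map x0) // nth_iota // index_uniq //.
Qed.

Lemma nth_map_index (T : eqType) S d (F : T -> S) (s : seq T) x :
  x \in s -> nth d [seq F y | y <- s] (index x s) = F x.
Proof. by move=> sx; rewrite (nth_map x) ?index_mem // nth_index. Qed.

Lemma enum_rank_index (T : finType) (x : T) :
  enum_rank x = index x (enum T) :> nat.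
Proof.
by rewrite -{2}(nth_enum_rank x x) index_uniq ?enum_uniq // -cardE.
Qed.

Lemma nth_map_rank (T : finType) S d (F : T -> S) x :
  nth d [seq F y | y <- enum T] (enum_rank x) = F x.
Proof. by rewrite enum_rank_index nth_map_index ?mem_enum. Qed.

Lemma map_rank_iota (T : finType) :
  [seq enum_rank x : nat | x <- enum T] = iota 0 #|T|.
Proof.
rewrite [in RHS]cardE -(map_index_iota (enum_uniq T)).
by apply: eq_map => x; apply: enum_rank_index.
Qed.

Lemma mem_tuples (T : eqType) (s : seq T) n t :
  (t \in tuples s n) = (size t == n) && all [in s] t.
Proof.
elim: n t => [|n IH] [|x t] //; rewrite [tuples _ _]/=.
  by apply/flatten_mapP => -[y _ /mapP[]].
rewrite /= eqSS; apply/flatten_mapP/idP => [[y sy /mapP[u u_n [-> ->]]]|].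
  by rewrite sy -/(tuples s n) IH in u_n *.
case/and3P=> sz sx st; exists x => //; apply/mapP; exists t => //.
by rewrite -/(tuples s n) IH sz.
Qed.

Lemma mem_subseqs (T : eqType) (s t : seq T) :
  t \in subseqs s -> {subset t <= s}.
Proof.
elim: s t => [|x s IH] t; first by rewrite inE => /eqP->.
rewrite /= mem_cat => /orP[/IH sub y /sub|/mapP[u /IH sub ->] y].
  by rewrite inE => ->; rewrite orbT.
by rewrite !inE => /orP[->//|/sub->]; rewrite orbT.
Qed.

Lemma filter_subseqs (T : eqType) (p : pred T) (s : seq T) :
  filter p s \in subseqs s.
Proof.
elim: s => //= x s IH; rewrite mem_cat.
by case: (p x); rewrite ?IH ?map_f ?orbT.
Qed.

Lemma mem_labels nagents bound nprops nboxes (l : label) :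
  (l \in labels nagents bound nprops nboxes)
  = [&& size l.1.1 == nprops, size l.1.2 == nboxes, size l.2 == nagents
      & all (fun a => a <= bound) l.2].
Proof.
have bools (t : seq bool) : all [in [:: true; false]] t by apply/allP => -[].
case: l => [[p k] a] /=; apply/flatten_mapP/and4P => [[p' + ]|[sp sk sa ba]].
  rewrite mem_tuples => /andP[sp _] /flatten_mapP[k'].
  rewrite mem_tuples => /andP[sk _] /mapP[a' + [-> -> ->]].
  rewrite mem_tuples => /andP[sa ba]; split=> //.
  by apply: sub_all ba => x; rewrite -[[in _] x]/(x \in iota _ _) mem_iota.
exists p; first by rewrite mem_tuples sp bools.
apply/flatten_mapP; exists k; first by rewrite mem_tuples sk bools.
apply/mapP; exists a => //; rewrite mem_tuples sa.
by apply: sub_all ba => x; rewrite -[[in _] x]/(x \in iota _ _) mem_iota.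
Qed.

(** Formulas and actions come without an equality test, so membership of lists of them is
    [List.In]. *)
Lemma In_nth T (x0 x : T) (s : seq T) :
  List.In x s -> exists2 j, j < size s & nth x0 s j = x.
Proof.
elim: s => //= y s IH [->|/IH[j lt_j <-]]; first by exists 0.
by exists j.+1.
Qed.

(** * Presentation of formulas and models *)

Section RawData.
Context {Phi : countType} {I : finType} {N : nat}.
Hypothesis I_gt0 : 0 < #|I|.
Implicit Types (M : structure Phi I N) (phi : form Phi I N).

Definition raw_atom (a : atom Phi I N) : ratom :=
  match a with
  | Prp p => RPrp (pickle p)
  | AttLt i n => RLt (enum_rank i) n
  | AttEq i n => REq (enum_rank i) n
  end.

Fixpoint raw_form (phi : form Phi I N) : rform :=
  match phi with
  | Top => RTop
  | At a => RAt (raw_atom a)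
  | Neg psi => RNeg (raw_form psi)
  | And psi chi => RAnd (raw_form psi) (raw_form chi)
  | K i psi => RK (enum_rank i) (raw_form psi)
  end.

(** The enumeration [e] of the worlds is a parameter because [rupdate] produces the worlds of an
    update in an order of its own, that of [update_enum]. *)
Definition raw_model (ps : seq Phi) M (e : seq M) (w : nat) : rstate :=
  RState
    [seq [seq [seq acc i x y | y <- e] | x <- e] | i <- enum I]
    [seq (pickle p, [seq x \in @Defs.val _ _ _ M (Prp p) | x <- e]) | p <- ps]
    [seq [seq att i x : nat | x <- e] | i <- enum I]
    w.

Lemma entry3_map (T : finType) (F : I -> T -> T -> bool) (s : seq T) i x y :
  x \in s -> y \in s ->
  entry3 [seq [seq [seq F i x y | y <- s] | x <- s] | i <- enum I]
    (enum_rank i) (index x s) (index y s) = F i x y.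
Proof. by move=> sx sy; rewrite /entry3 nth_map_rank !nth_map_index. Qed.

Lemma entry2_map (T : finType) (F : I -> T -> nat) (s : seq T) i x :
  x \in s ->
  entry2 [seq [seq F i x | x <- s] | i <- enum I] (enum_rank i) (index x s)
  = F i x.
Proof. by move=> sx; rewrite /entry2 nth_map_rank nth_map_index. Qed.

Lemma nworlds_raw ps M (e : seq M) w : nworlds (raw_model ps e w) = size e.
Proof.
rewrite /nworlds /=; move: I_gt0; rewrite cardE.
by case: (enum I) => //= i s _; rewrite size_map.
Qed.

Lemma rval_of_raw ps M (e : seq M) w p : p \in ps ->
  rval_of (raw_model ps e w) (pickle p)
  = [seq x \in @Defs.val _ _ _ M (Prp p) | x <- e].
Proof.
rewrite /rval_of /=; elim: ps => //= q ps IH.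
rewrite (inj_eq (pcan_inj (@pickleK Phi))) inE eq_sym.
by case: eqP => [->|_] //=.
Qed.

Lemma truth_raw ps M (e : seq M) w phi :
  uniq e -> (forall x, x \in e) -> {subset form_props phi <= ps} ->
  truth (raw_model ps e w) (raw_form phi) = [seq sat x phi | x <- e].
Proof.
move=> ue ein; rewrite /truth nworlds_raw -(map_index_iota ue).
elim: phi => [|[p|i n|i n]|psi IH|psi IHpsi chi IHchi|i psi IH] /= sub.
- by rewrite -map_comp.
- by rewrite rval_of_raw // sub ?inE.
- by rewrite nth_map_rank -map_comp.
- rewrite nth_map_rank -map_comp; apply: eq_map => x /=.
  by rewrite -val_eqE.
- by rewrite IH // -map_comp.
- rewrite IHpsi ?IHchi; first last.
  + by move=> p p_psi; apply: sub; rewrite mem_cat p_psi.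
  + by move=> p p_chi; apply: sub; rewrite mem_cat p_chi orbT.
  by rewrite -map_comp; apply: eq_map => x /=; rewrite !nth_map_index.
- rewrite {}IH // -map_comp; apply: eq_map => x /=.
  rewrite all_map; apply/allP/forallP => [sat_e y|sat_M y _] /=.
    by move: (sat_e y (ein y)) => /=; rewrite entry3_map // nth_map_index.
  by rewrite entry3_map // nth_map_index.
Qed.

Fixpoint boxes phi : seq (I * form Phi I N) :=
  match phi with
  | Top => [::]
  | At _ => [::]
  | Neg psi => boxes psi
  | And psi chi => boxes psi ++ boxes chi
  | K i psi => (i, psi) :: boxes psi
  end.

Lemma rprops_raw phi : rprops (raw_form phi) = map pickle (form_props phi).
Proof.
elim: phi => //= [[]//|psi IHpsi chi IHchi].
by rewrite /rprops /= -/(rprops _) IHpsi -/(rprops _) IHchi map_cat.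
Qed.

Definition box_agents (bs : seq (I * form Phi I N)) : seq nat :=
  [seq enum_rank b.1 : nat | b <- bs].

Lemma rboxes_raw phi : rboxes (raw_form phi) = box_agents (boxes phi).
Proof.
rewrite /box_agents; elim: phi => //= [psi IHpsi chi IHchi|i psi IH].
  by rewrite /rboxes /= -/(rboxes _) IHpsi -/(rboxes _) IHchi map_cat.
by rewrite /rboxes /= -/(rboxes _) IH.
Qed.

(** * Filtration *)

Section LabelStructure.
Context (ps : seq Phi) (bs : seq (I * form Phi I N)) (S : seq label).

Let label0 : label := ([::], [::], [::]).
Definition label_of (a : 'I_(size S)) : label := nth label0 S a.

Definition label_structure : structure Phi I N :=
  @Structure Phi I N 'I_(size S)
    (fun i a b =>
      label_rel (box_agents bs) (enum_rank i) (label_of a) (label_of b))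
    (fun x => match x with
              | Prp p => [set a | nth false (label_of a).1.1 (index p ps)]
              | AttLt _ _ => set0
              | AttEq _ _ => set0
              end)
    (fun i a => inord (nth 0 (label_of a).2 (enum_rank i))).

Lemma map_label_of T (F : label -> T) :
  [seq F l | l <- S] = [seq F (label_of a) | a <- enum 'I_(size S)].
Proof.
rewrite -{1}(mkseq_nth label0 S) /mkseq -val_enum_ord -!map_comp.
exact: eq_map.
Qed.

Lemma label_state_raw :
  (forall l, l \in S -> all (fun n => n <= N) l.2) ->
  label_state #|I| (map pickle ps) (box_agents bs) S
  = raw_model ps (enum label_structure) 0.
Proof.
move=> leS; rewrite /label_state /raw_model -map_rank_iota -!map_comp.
congr RState; apply: eq_map => i /=.
- by rewrite map_label_of; apply: eq_map => a; rewrite map_label_of.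
- rewrite map_label_of; congr pair; apply: eq_map => a.
  by rewrite inE index_map //; apply: pcan_inj (@pickleK Phi).
- rewrite map_label_of; apply: eq_map => a; rewrite inordK // ltnS.
  have /leS/allP le_a : label_of a \in S by apply: mem_nth.
  have [lt_i|le_i] := ltnP (enum_rank i) (size (label_of a).2).
    by apply/le_a/mem_nth.
  by rewrite nth_default.
Qed.

Lemma label_attention_model : 0 < size S -> attention_model label_structure.
Proof.
move=> S_gt0; split=> [|i|i a b /andP[/eqP eq_i _]] /=.
- by rewrite card_ord.
- split=> [a|a b|b a c] /=; rewrite /label_rel.
  + by rewrite eqxx; apply/allP => j _; rewrite eqxx implybT.
  + rewrite eq_sym; congr (_ && _); apply: eq_all => j.
    by rewrite (eq_sym (nth _ _ _) (nth _ _ _)).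
  + case/andP=> /eqP-> /allP ab /andP[-> /allP bc] /=; apply/allP => j js.
    by apply/implyP => j_i; move: (ab j js) (bc j js); rewrite j_i => /eqP->.
- by rewrite eq_i.
Qed.

Section Filtration.
Context (M : structure Phi I N).
Hypothesis model_M : attention_model M.

Definition world_label (w : M) : label :=
  ([seq w \in @Defs.val _ _ _ M (Prp p) | p <- ps],
   [seq sat w (K b.1 b.2) | b <- bs],
   [seq att i w : nat | i <- enum I]).

Hypothesis labelS : forall w, world_label w \in S.
Hypothesis Slabel : forall l, l \in S -> exists w, world_label w = l.

(** The filtration lemma. For [K]: worlds related by [acc i] have equal [i]-levels and, by symmetry
    and transitivity, satisfy the same [i]-boxes, so their labels are related. Conversely, related
    labels agree on [K i psi], and reflexivity yields [psi] at the world realising the second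
    label. *)
Lemma sat_label_structure phi (a : label_structure) (w : M) :
  {subset form_props phi <= ps} ->
  (forall b, List.In b (boxes phi) -> List.In b bs) ->
  label_of a = world_label w -> sat a phi = sat w phi.
Proof.
have [_ equivM attM] := model_M.
elim: phi a w => [|[p|i n|i n]|psi IH|psi IHpsi chi IHchi|i psi IH] a w //=.
- move=> sub _ aw; rewrite inE aw nth_map_index // sub ?inE //.
- by move=> _ _ aw; rewrite aw /= nth_map_rank inordK.
- by move=> _ _ aw; rewrite aw /= nth_map_rank inord_val.
- by move=> sub subb aw; rewrite (IH a w).
- move=> sub subb aw; rewrite (IHpsi a w) ?(IHchi a w) //.
  + by move=> p pchi; apply: sub; rewrite mem_cat pchi orbT.
  + by move=> b bchi; apply: subb; apply/List.in_app_iff; right.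
  + by move=> p ppsi; apply: sub; rewrite mem_cat ppsi.
  + by move=> b bpsi; apply: subb; apply/List.in_app_iff; left.
move=> sub subb aw; have [refl_i sym_i trans_i] := equivM i.
have {}IH (a' : label_structure) w' :
    label_of a' = world_label w' -> sat a' psi = sat w' psi.
  by apply: IH => // b b_psi; apply: subb; right.
have [j lt_j bj] : exists2 j, j < size bs & nth (i, psi) bs j = (i, psi).
  by apply: In_nth; apply: subb; left.
rewrite aw; apply/forallP/forallP => sat_psi.
- move=> v; apply/implyP => wv.
  have lt_v := labelS v; rewrite -index_mem in lt_v.
  pose b : label_structure := Ordinal lt_v.
  have label_v : label_of b = world_label v by apply: nth_index.
  rewrite -(IH _ _ label_v); apply: (implyP (sat_psi _)).
  rewrite label_v /label_rel /= !nth_map_rank (attM i w v wv) eqxx /=.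
  apply/allP => k; rewrite mem_iota size_map => /= lt_k.
  rewrite !(nth_map (i, psi)) //; apply/implyP => /eqP/val_inj/enum_rank_inj->.
  apply/eqP/eq_forallb => u; congr (_ ==> _).
  by apply/idP/idP; apply: trans_i => //; rewrite sym_i.
move=> b; apply/implyP => ab.
have [v vb] : exists v, world_label v = label_of b.
  exact/Slabel/mem_nth.
rewrite (IH b v) //; move: ab; rewrite -vb => /andP[_ /allP/(_ j)].
rewrite mem_iota size_map lt_j !(nth_map (i, psi)) // bj eqxx.
move=> /(_ isT)/eqP eq_K.
have /forallP : sat v (K i psi) by rewrite -eq_K; apply/forallP.
by move=> /(_ v)/implyP; apply.
Qed.
End Filtration.
End LabelStructure.

Lemma rentails_raw phi psi :
  rentails #|I| N (raw_form phi) (raw_form psi) = `[< entails phi psi >].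
Proof.
rewrite /rentails !rprops_raw !rboxes_raw -map_cat /box_agents -map_cat.
set ps := form_props phi ++ _; set bs := boxes phi ++ _.
rewrite !size_map -/(box_agents bs).
have subphi : {subset form_props phi <= ps}.
  by move=> p pphi; rewrite mem_cat pphi.
have subpsi : {subset form_props psi <= ps}.
  by move=> p ppsi; rewrite mem_cat ppsi orbT.
apply/allP/asboolP => [ent s att_s sat_phi|ent S /mem_subseqs subS].
  (* The labels realised in [s], obtained by filtering [labels] so that the result is one of its
     [subseqs]. *)
  pose S := [seq l <- labels #|I| N (size ps) (size bs)
            | [exists w : s, world_label ps bs w == l]].
  have labelS (w : s) : world_label ps bs w \in S.
    have sz : size (world_label ps bs w).2 = #|I| by rewrite size_map -cardE.
    rewrite mem_filter mem_labels sz !size_map !eqxx andTb andTb andTb.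
    apply/andP; split; first by apply/existsP; exists w.
    by rewrite all_map; apply/allP => i _ /=; rewrite -ltnS.
  have Slabel l : l \in S -> exists w : s, world_label ps bs w = l.
    by rewrite mem_filter => /andP[/existsP[w /eqP]]; exists w.
  have leS l : l \in S -> all (fun n => n <= N) l.2.
    by rewrite mem_filter mem_labels => /andP[_ /and4P[]].
  have lt_a := labelS (actual s); rewrite -index_mem in lt_a.
  pose a : label_structure ps bs S := Ordinal lt_a.
  have label_a : label_of a = world_label ps bs (actual s) by apply: nth_index.
  have /allP := ent S (filter_subseqs _ _).
  move=> /(_ (index a (enum (label_structure ps bs S)))).
  rewrite label_state_raw // !truth_raw ?enum_uniq // => [|x|x];
    rewrite ?mem_enum //.
  rewrite !nth_map_index ?mem_enum // index_enum_ord mem_iota lt_a.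
  rewrite !(sat_label_structure att_s labelS Slabel _ _ label_a) //.
  - by move=> /(_ isT)/implyP; apply.
  - by move=> b b_psi; apply/List.in_app_iff; right.
  - by move=> b b_phi; apply/List.in_app_iff; left.
have leS l : l \in S -> all (fun n => n <= N) l.2.
  by move=> /subS; rewrite mem_labels => /and4P[].
apply/allP => k; rewrite mem_iota => /= lt_k.
rewrite label_state_raw // !truth_raw ?enum_uniq // => [|x|x];
  rewrite ?mem_enum //.
pose a : label_structure ps bs S := Ordinal lt_k.
have -> : k = index a (enum (label_structure ps bs S)).
  by rewrite index_enum_ord.
rewrite !nth_map_index ?mem_enum //; apply/implyP.
(* The structure built from any tested set is an attention model; the world [k] shows that the set
   is nonempty. *)
apply: (ent (State a)); apply: label_attention_model.
exact: leq_ltn_trans (leq0n k) lt_k.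
Qed.

(** * Presentation of updates *)

Definition raw_state (ps : seq Phi) (s : state Phi I N) (e : seq s) : rstate :=
  raw_model ps e (index (actual s) e).

Definition raw_action (X : action Phi I N) : raction :=
  RAction
    [seq [seq [seq dep i f g | g <- enum X] | f <- enum X] | i <- enum I]
    [seq [seq [seq qdep i f g | g <- enum X] | f <- enum X] | i <- enum I]
    [seq raw_form (pre f) | f <- enum X]
    [seq [seq cost i (question X i) f | f <- enum X] | i <- enum I]
    [seq raw_form (question X i) | i <- enum I]
    (enum_rank (actual_event X)).

Lemma rpre_of_raw (X : action Phi I N) (f : X) :
  rpre_of (raw_action X) (enum_rank f) = raw_form (pre f).
Proof. exact: nth_map_rank. Qed.

Lemma rholds_raw ps (s : state Phi I N) (e : seq s) phi :
  uniq e -> (forall x, x \in e) -> {subset form_props phi <= ps} ->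
  rholds (raw_state ps e) (raw_form phi) = sat (actual s) phi.
Proof. by move=> ue ein sub; rewrite /rholds truth_raw // nth_map_index. Qed.

Section Update.
Context (ps : seq Phi) (s : state Phi I N) (e : seq s) (X : action Phi I N).
Hypotheses (ue : uniq e) (ein : forall x, x \in e).
Hypothesis props_X : {subset action_props X <= ps}.

Lemma pre_props (f : X) : {subset form_props (pre f) <= ps}.
Proof.
move=> p pf; apply: props_X; rewrite mem_cat; apply/orP; left.
by apply/flatten_mapP; exists f; rewrite ?mem_enum.
Qed.

(** Lexicographic order of the pairs, matching the nested loops of [rupdate_worlds]. *)
Definition update_enum : seq (update s X) :=
  pmap insub [seq (v, f) | v <- e, f <- enum X].

Lemma update_enum_uniq : uniq update_enum.
Proof.
apply: pmap_sub_uniq; apply: allpairs_uniq => //; first exact: enum_uniq.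
by move=> [a b] [c d] _ _ [-> ->].
Qed.

Lemma mem_update_enum x : x \in update_enum.
Proof.
rewrite mem_pmap_sub; case: (\val x) => v f.
by apply: allpairs_f; rewrite ?mem_enum.
Qed.

Definition world_rank (x : update s X) : nat * nat :=
  (index (\val x).1 e, enum_rank (\val x).2 : nat).

Lemma world_rank_inj : injective world_rank.
Proof.
move=> x y [eq1 /val_inj/enum_rank_inj eq2]; apply: val_inj.
rewrite (surjective_pairing (\val x)) (surjective_pairing (\val y)) eq2.
by rewrite -(nth_index (actual s) (ein (\val x).1)) eq1 nth_index.
Qed.

Lemma rupdate_worlds_raw :
  rupdate_worlds (raw_state ps e) (raw_action X) = map world_rank update_enum.
Proof.
rewrite /rupdate_worlds nworlds_raw size_map -cardE -(map_index_iota ue).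
pose rk (x : s * X) : nat * nat := (index x.1 e, enum_rank x.2 : nat).
have -> : map world_rank update_enum = map rk (map \val update_enum).
  by rewrite -map_comp.
rewrite /update_enum (pmap_filter (insubK _)).
have -> : flatten [seq [seq (w, f) | f <- iota 0 #|X|]
                  | w <- [seq index x e | x <- e]]
    = map rk [seq (v, f) | v <- e, f <- enum X].
  rewrite map_flatten -!map_comp; congr flatten; apply: eq_map => v /=.
  by rewrite -map_rank_iota -!map_comp.
rewrite filter_map; congr map; apply: eq_in_filter => -[v f] _ /=.
rewrite rpre_of_raw truth_raw //; last exact: pre_props.
by rewrite nth_map_index // isSome_insub.
Qed.

Lemma map_iota_rank (T : finType) S (F : nat -> S) :
  [seq F k | k <- iota 0 #|T|] = [seq F (enum_rank x) | x <- enum T].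
Proof. by rewrite -map_rank_iota -map_comp. Qed.

Lemma rupdate_raw (h : applicable s X) :
  rupdate #|I| N (raw_state ps e) (raw_action X)
  = raw_state (s := update_state h) ps update_enum.
Proof.
rewrite /rupdate rupdate_worlds_raw {2}/raw_state /raw_model !map_iota_rank.
congr RState.
- apply: eq_map => i /=; rewrite -map_comp; apply: eq_map => x /=.
  rewrite -map_comp; apply: eq_map => y /=.
  rewrite /rupdate_rel /upd_acc /world_rank.
  case: (\val x) (\val y) => v f [u g] /=.
  rewrite !rpre_of_raw nth_map_rank !rentails_raw !(@enum_rank_index (event X)).
  rewrite !entry3_map ?entry2_map ?mem_enum //; congr (_ && (_ || _)).
  (* [rentails] decides each entailment separately, so the equivalence in [qdep_refine] has to
     become an equality of two Booleans. *)
  have asbool_iff P Q : `[< P <-> Q >] = (`[< P >] == `[< Q >]).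
    by apply/asboolP/eqP; [apply: asbool_equiv_eq | apply: asbool_eq_equiv].
  by rewrite /qdep_refine /= asbool_iff; case: ltnP => _; rewrite ?andbT.
- rewrite -map_comp; apply: eq_map => p /=; congr pair; rewrite -map_comp.
  apply: eq_map => x /=.
  by rewrite nth_map_index // inE.
- apply: eq_map => i /=; rewrite -map_comp.
  apply: eq_map => -[[v f] vf] /=.
  by rewrite !(@enum_rank_index (event X)) !entry2_map ?mem_enum.
rewrite -(index_map world_rank_inj).
by elim: (map _ _) => //= x l ->.
Qed.
End Update.

End RawData.

(** * Bounding the length of plans *)

Section Bisimulation.
Context {Phi : countType} {I : finType} {N : nat}.

(** Attention atoms are compared through [att], which [sat] reads, and not through the valuation. *)
Definition bisimulation (M M' : structure Phi I N) (Z : M -> M' -> Prop) :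
    Prop :=
  forall w w', Z w w' ->
    [/\ forall p, (w \in @Defs.val _ _ _ M (Prp p))
                  = (w' \in @Defs.val _ _ _ M' (Prp p)),
        forall i, att i w = att i w',
        forall i v, acc i w v -> exists2 v', acc i w' v' & Z v v'
      & forall i v', acc i w' v' -> exists2 v, acc i w v & Z v v'].

Definition bisimilar (s s' : state Phi I N) : Prop :=
  exists2 Z : s -> s' -> Prop, bisimulation Z & Z (actual s) (actual s').

Lemma sat_bisim (M M' : structure Phi I N) (Z : M -> M' -> Prop) phi w w' :
  bisimulation Z -> Z w w' -> sat w phi = sat w' phi.
Proof.
move=> bisimZ.
elim: phi w w' => [|[p|i n|i n]|psi IH|psi IHpsi chi IHchi|i psi IH]
  w w' Zww' //=;
  have [eq_val eq_att forth back] := bisimZ _ _ Zww'.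
- exact: eq_val.
- by rewrite eq_att.
- by rewrite eq_att.
- by rewrite (IH w w').
- by rewrite (IHpsi w w') ?(IHchi w w').
apply/forallP/forallP => sat_psi v; apply/implyP.
  move=> /back[u acc_u Zu].
  by rewrite -(IH _ _ Zu); apply: (implyP (sat_psi u)).
move=> /forth[u acc_u Zu].
by rewrite (IH _ _ Zu); apply: (implyP (sat_psi u)).
Qed.

Lemma bisimilar_sym s s' : bisimilar s s' -> bisimilar s' s.
Proof.
case=> Z bisimZ Zss'; exists (fun w' w => Z w w') => // w' w.
move=> /bisimZ[va at' fo ba].
by split=> // [p|i]; rewrite ?va ?at'.
Qed.

(** Whether a question is affordable depends on the level, which [Z] preserves, and the refinement
    of [qdep] on the events alone; so [Z] paired with equality of events is again a bisimulation. *)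
Lemma bisimilar_update s s' (X : action Phi I N) (h : applicable s X)
    (h' : applicable s' X) :
  bisimilar s s' -> bisimilar (update_state h) (update_state h').
Proof.
case=> Z bisimZ Zss'.
exists (fun x x' => Z (\val x).1 (\val x').1 /\ (\val x).2 = (\val x').2)
  => //.
move=> [[w f] wf] [[w' f'] wf'] /= [Zww' eq_f]; rewrite -{}eq_f {f'} in wf' *.
have [va at' forth back] := bisimZ _ _ Zww'.
split=> [p|i|i [[v g] vg]|i [[v' g] v'g]] /=.
- by rewrite !inE /= va.
- by apply: val_inj; rewrite /= at'.
- case/andP=> /forth[v' acc_v' Zvv'] fg.
  have v'g : sat v' (pre g) by rewrite -(sat_bisim _ bisimZ Zvv').
  exists (exist (fun x : s' * X => sat x.1 (pre x.2)) (v', g) v'g) => //.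
  by rewrite /upd_acc /= acc_v' -at'.
- case/andP=> /back[v acc_v Zvv'] fg.
  have vg : sat v (pre g) by rewrite (sat_bisim _ bisimZ Zvv').
  exists (exist (fun x : s * X => sat x.1 (pre x.2)) (v, g) vg) => //.
  by rewrite /upd_acc /= acc_v at'.
Qed.

Lemma achieves_bisim s s' (Xs : seq (action Phi I N)) phi :
  bisimilar s s' -> achieves s Xs phi -> achieves s' Xs phi.
Proof.
elim: Xs s s' => [|X Xs IH] s s' ss' /=; have [Z bisimZ Zss'] := ss'.
  by rewrite (sat_bisim _ bisimZ Zss').
case=> h ach; have h' : applicable s' X.
  by rewrite /applicable -(sat_bisim _ bisimZ Zss').
by exists h'; apply: IH ach; apply: bisimilar_update.
Qed.

Definition restrict (M : structure Phi I N) (U : {set M}) : structure Phi I N :=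
  @Structure Phi I N {w : M | w \in U}
    (fun i x y => acc i (\val x) (\val y))
    (fun p => [set x | \val x \in @Defs.val _ _ _ M p])
    (fun i x => att i (\val x)).

Definition restrict_state (s : state Phi I N) (U : {set s})
    (hU : actual s \in U) : state Phi I N :=
  @State Phi I N (restrict U) (exist (fun w => w \in U) (actual s) hU).

Lemma restrict_full (s : state Phi I N) (U : {set s}) (hU : actual s \in U) :
  (forall w, w \in U) -> bisimilar (restrict_state hU) s.
Proof.
move=> fullU; exists (fun x w => \val x = w) => // -[w Uw] _ /= <-.
split=> [p|i|i [v Uv]|i v] //=; first by rewrite inE.
- by move=> acc_v; exists v.
- by move=> acc_v; exists (exist (fun w => w \in U) v (fullU v)).
Qed.

(* In an idle update nobody learns more than the disjunction of the
   preconditions. *)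
Definition idle (s : state Phi I N) (X : action Phi I N) : Prop :=
  forall i, question X i = Top \/ forall w : s, att i w = 0 :> nat.

(** Each accessible world that survives must be reached from any event. As [qdep] is total this is
    immediate when the question is too expensive. An affordable question must be [Top], since a
    positive cost cannot be paid at level 0; and every precondition entails [Top], so the refinement
    removes nothing. Levels stay put because [Top] is free and level 0 cannot fall. *)
Lemma idle_bisim (s : state Phi I N) (X : action Phi I N) (U : {set s})
    (hU : actual s \in U) (h : applicable s X) :
  NFL X -> idle s X -> (forall w, w \in U = [exists f : X, sat w (pre f)]) ->
  bisimilar (update_state h) (restrict_state hU).
Proof.
move=> nflX idleX UE.
exists (fun (x : update_state h) (w : restrict_state hU) =>
  (\val x).1 = \val w) => //.
move=> [[w f] wf] [w' Uw] /= eq_w; rewrite -{}eq_w {w'} in Uw *.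
have cost_idle i : att i w - cost i (question X i) f = att i w :> nat.
  case: (idleX i) => [->|->]; last by rewrite sub0n.
  by rewrite cost_top subn0.
split=> [p|i|i [[v g] vg]|i [v Uv]] /=.
- by rewrite !inE.
- by apply: val_inj; apply: cost_idle.
- case/andP=> acc_v _.
  have Uv : v \in U by rewrite UE; apply/existsP; exists g.
  by exists (exist (fun w => w \in U) v Uv).
move=> acc_v; move: (Uv); rewrite UE => /existsP[g vg].
exists (exist (fun x : s * X => sat x.1 (pre x.2)) (v, g) vg) => //.
rewrite /upd_acc /= acc_v /=; apply/orP; right.
have [qdepX costX] := nflX i.
case: ltnP => [_|le_cost]; first exact: qdepX.
rewrite /qdep_refine qdepX; apply/asboolP.
have -> : question X i = Top; last by split.
case: (idleX i) => // att0; apply: contrapT => /(costX _ f).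
by rewrite ltnNge (leq_trans le_cost) // att0.
Qed.

(** Pays for an idle update that loses a world. *)
Lemma plan_bound_restrict E n m : 0 < E ->
  (plan_bound E n m).+1 <= plan_bound E n.+1 m.
Proof.
move=> E_gt0; rewrite /plan_bound ltn_pmul2l // ltn_add2r.
by rewrite ltn_pmul2r ?expn_gt0 ?E_gt0.
Qed.

(** Pays for a non-idle update: the model may grow by the factor [E], but one unit of attention is
    gone. *)
Lemma plan_bound_update E n m :
  (plan_bound E (n * E) m).+1 <= plan_bound E n m.+1.
Proof.
by rewrite /plan_bound -mulnA -expnS [leqRHS]mulSn addn1 addSn ltnS leq_addl.
Qed.

(** Induction on the attention bound [m], then on the plan. The inner induction is not on [n],
    because dropping an idle update that loses no world decreases only the length of the plan. The
    function [b] bounds the levels from above, so that it can be lowered explicitly without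
    computing maxima. *)
Lemma short_plan E (acts : seq (action Phi I N)) phi m n (b : I -> nat)
    (s : state Phi I N) Xs :
  0 < E -> (forall X, List.In X acts -> NFL X /\ #|X| <= E) ->
  #|s| <= n -> (forall i (w : s), att i w <= b i) -> \sum_i b i <= m ->
  (forall X, List.In X Xs -> List.In X acts) -> achieves s Xs phi ->
  exists Ys, [/\ size Ys <= plan_bound E n m,
                 forall X, List.In X Ys -> List.In X acts & achieves s Ys phi].
Proof.
move=> E_gt0 actsP.
elim/ltn_ind: m n b s Xs => m IHm n b s Xs le_n le_b sum_b.
elim: Xs n s le_n le_b => [|X Xs IHXs] n s le_n le_b.
  by move=> _ ach; exists [::].
move=> Xs_acts [h ach].
have [nflX le_E] := actsP X (Xs_acts X (or_introl erefl)).
have actsX : List.In X acts by apply: Xs_acts; left.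
have {}Xs_acts Y : List.In Y Xs -> List.In Y acts.
  by move=> Xs_Y; apply: Xs_acts; right.
have X_acts Ys k k' : (forall Y, List.In Y Ys -> List.In Y acts) ->
  achieves (update_state h) Ys phi -> size Ys <= k -> k < k' ->
  exists Zs, [/\ size Zs <= k', forall Y, List.In Y Zs -> List.In Y acts
                & achieves s Zs phi].
  move=> Ys_acts achYs sz lt_k; exists (X :: Ys); split; last by exists h.
    exact: leq_ltn_trans lt_k.
  by move=> Y [<-|/Ys_acts]; first exact: actsX.
have [idleX|] := pselect (idle s X); last first.
  move=> /existsNP[i /not_orP[/= q_i /existsNP[w /eqP att_w]]].
  (* Every agent whose question is not [Top] pays at least 1 at each world, so [(b j).-1] still
     bounds the new levels. For [i], level and hence [b i] are positive at the start, so the sum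
     drops strictly. *)
  pose b' j := if `[< question X j = Top >] then b j else (b j).-1.
  have lt_b : \sum_j b' j < \sum_j b j.
    rewrite (bigD1 i) //= [ltnRHS](bigD1 i) //= -addSn leq_add //.
      rewrite /b' asboolF // prednK // (leq_trans _ (le_b i w)) // lt0n //.
    by apply: leq_sum => j _; rewrite /b'; case: ifP => // _; apply: leq_pred.
  case: m => [|m] in IHm sum_b {IHXs} *.
    by rewrite leqNgt (leq_ltn_trans _ lt_b) in sum_b.
  have [] := IHm m (ltnSn m) (n * E) b' (update_state h) Xs => //.
  - rewrite card_sig (leq_trans (max_card _)) // card_prod leq_mul //.
  - move=> j [[v f] vf] /=; rewrite /b'; case: asboolP => q_j.
      by rewrite (leq_trans (leq_subr _ _)).
    have [_ /(_ _ f q_j) cost_gt0] := nflX j.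
    by rewrite -subn1 leq_sub.
  - by rewrite -ltnS (leq_trans lt_b).
  move=> Ys [sz Ys_acts achY]; apply: X_acts achY sz _ => //.
  exact: plan_bound_update.
pose U := [set w : s | [exists f : X, sat w (pre f)]].
have UE w : (w \in U) = [exists f : X, sat w (pre f)] by rewrite inE.
have hU : actual s \in U by rewrite UE; apply/existsP; exists (actual_event X).
have bisU := idle_bisim hU h nflX idleX UE.
have achU := achieves_bisim bisU ach.
have [fullU|properU] := boolP [forall w, w \in U].
  (* No world is lost: [s] itself is bisimilar to its update, and [X] can be omitted. *)
  have full := restrict_full hU (fun w => forallP fullU w).
  exact: IHXs le_n le_b Xs_acts (achieves_bisim full achU).
case: n => [|n] in le_n *.
  by move: le_n; rewrite leqn0 => /eqP/card0_eq/(_ (actual s)); rewrite inE.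
(* A short plan is found for the smaller restricted state, then carried back to the real update and
   prefixed with [X]. *)
have [] := IHXs n (restrict_state hU) _ _ Xs_acts achU.
- have lt_U : #|U| < #|s|.
    rewrite -cardsT; apply: proper_card; rewrite properEneq subsetT andbT.
    by apply: contra properU => /eqP->; apply/forallP => w; rewrite inE.
  rewrite card_sig -ltnS; apply: leq_trans le_n; apply: leq_trans lt_U.
  by rewrite ltnS; apply/subset_leq_card/subsetP.
- by move=> i w; apply: le_b.
move=> Ys [sz Ys_acts achY].
apply: (X_acts Ys) sz (plan_bound_restrict _ _ E_gt0) => //.
exact: achieves_bisim (bisimilar_sym bisU) achY.
Qed.
End Bisimulation.

(** * Correctness of the decision procedure *)

Section Search.
Context (nagents bound : nat) (actions : seq raction) (goal : rform).

(** Follows one plan from its first action, as [achieves] does, whereas [expand] advances all states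
    by one level. *)
Fixpoint reachable (k : nat) (r : rstate) : bool :=
  if k is k'.+1 then
    reachable k' r ||
    has (fun X => rapplicable r X && reachable k' (rupdate nagents bound r X))
      actions
  else rholds r goal.

Lemma has_expand k rs :
  has (fun r => rholds r goal) (iter k (expand nagents bound actions) rs)
  = has (reachable k) rs.
Proof.
elim: k rs => [|k IH] rs //; rewrite iterSr IH /expand has_cat /=.
rewrite -[RHS]/(has (predU (reachable k) _) rs) has_predU; congr (_ || _).
elim: rs => //= r rs <-; rewrite has_cat; congr (_ || _).
by elim: actions => //= X Xs <-; case: (rapplicable r X).
Qed.

End Search.

Lemma hasP_In T (p : T -> bool) (s : seq T) :
  reflect (exists2 x, List.In x s & p x) (has p s).
Proof.
elim: s => [|x s IH] /=; first by right=> -[].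
apply: (iffP orP) => [[px|/IH[y sy py]]|[y [<-|sy] py]].
- by exists x => //; left.
- by exists y => //; right.
- by left.
- by right; apply/IH; exists y.
Qed.

(** The enumeration [e] varies in the induction, since each update brings its own; [ps] stays fixed,
    as updates create no propositions. *)
Lemma reachable_raw (Phi : countType) (I : finType) N (ps : seq Phi)
    (acts : seq (action Phi I N)) (phi : form Phi I N) k (s : state Phi I N)
    (e : seq s) :
  0 < #|I| -> uniq e -> (forall x, x \in e) ->
  (forall X, List.In X acts -> {subset action_props X <= ps}) ->
  {subset form_props phi <= ps} ->
  reachable #|I| N (map raw_action acts) (raw_form phi) k (raw_state ps e) <->
  exists Xs, [/\ size Xs <= k, forall X, List.In X Xs -> List.In X acts
               & achieves s Xs phi].
Proof.
move=> I_gt0 + + props_acts props_phi.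
elim: k s e => [|k IH] s e ue ein /=.
  rewrite rholds_raw //; split=> [sat_phi|[[|X Xs] [//]]].
  by exists [::].
have applicableE X : List.In X acts ->
    rapplicable (raw_state ps e) (raw_action X)
    = sat (actual s) (pre (actual_event X)).
  move=> X_acts; rewrite /rapplicable rpre_of_raw rholds_raw //.
  by move=> p; apply: pre_props; apply: props_acts.
split=> [/orP[/(IH _ _ ue ein)[Xs [sz acts_Xs ach]]|]
        |[[|X Xs] [sz acts_Xs ach]]].
- by exists Xs; split=> //; apply: leqW.
- case/hasP_In => _ /List.in_map_iff[X [<- X_acts]].
  rewrite applicableE // => /andP[h].
  rewrite (rupdate_raw I_gt0 ue ein (props_acts X X_acts) h).
  case/(IH (update_state h) _ (update_enum_uniq X ue) (mem_update_enum ein)).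
  move=> Xs [sz acts_Xs ach].
  exists (X :: Xs); split=> //; last by exists h.
  by move=> Y [<-|/acts_Xs].
- by apply/orP; left; apply/IH => //; exists [::].
have X_acts : List.In X acts by apply: acts_Xs; left.
case: ach => h ach; apply/orP; right; apply/hasP_In; exists (raw_action X).
  exact: List.in_map.
rewrite applicableE // h (rupdate_raw I_gt0 ue ein (props_acts X X_acts) h) /=.
apply/(IH (update_state h) _ (update_enum_uniq X ue) (mem_update_enum ein)).
by exists Xs; split=> // Y Xs_Y; apply: acts_Xs; right.
Qed.

(** * Codes of tasks *)

Section Task.
Context {Phi : countType}.
Implicit Types T : task Phi.

Definition raw_task T : rtask :=
  RTask #|agent T| (bound T)
    (raw_state (task_props T) (enum (model (init T))))
    (map raw_action (actions T)) (raw_form (goal T)).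

Lemma enc_map_fun (T : finType) A {eA : encodable A} (f : T -> A)
    (g : T -> term) :
  (forall x, enc (f x) = g x) -> enc [seq f x | x <- enum T] = enc_fun g.
Proof.
move=> fg; rewrite -[LHS]/(enc_seq _) /enc_fun -map_comp; congr enc_seq.
exact: eq_map.
Qed.

Lemma enc_raw_form (I : finType) N (phi : form Phi I N) :
  enc (raw_form phi) = enc_form phi.
Proof.
have encE x : enc x = enc_rform x by [].
rewrite encE; elim: phi => //= [[]//|psi ->//|psi -> chi ->//|i psi ->//].
Qed.

Lemma enc_raw_action (I : finType) N (X : action Phi I N) :
  enc (raw_action X) = enc_action X.
Proof.
rewrite -[LHS]/(enc_tuple _) /raction_args /=.
do ![congr cons | congr enc_tuple] => //.
- by apply: enc_map_fun => i; do 2 apply: enc_map_fun => ?.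
- by apply: enc_map_fun => i; do 2 apply: enc_map_fun => ?.
- by apply: enc_map_fun => f; apply: enc_raw_form.
- by apply: enc_map_fun => i; apply: enc_map_fun.
- by apply: enc_map_fun => i; apply: enc_raw_form.
Qed.

Lemma enc_raw_state (I : finType) N ps (s : state Phi I N) :
  enc (raw_state ps (enum (model s))) = enc_state ps s.
Proof.
rewrite -[LHS]/(enc_tuple _) /rstate_args /=.
do ![congr cons | congr enc_tuple] => //.
- by apply: enc_map_fun => i; do 2 apply: enc_map_fun => ?.
- rewrite -[LHS]/(enc_seq _) -map_comp; congr enc_seq; apply: eq_map => p /=.
  rewrite -[LHS]/(enc_tuple _) /=; do ![congr cons | congr enc_tuple] => //.
  exact: enc_map_fun.
- by apply: enc_map_fun => i; apply: enc_map_fun.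
- by rewrite /enc_elt enum_rank_index.
Qed.

(** An equality of terms: the program for [solvable] runs on the given code of the task without any
    translation. *)
Lemma enc_raw_task T : enc (raw_task T) = enc_task T.
Proof.
rewrite -[LHS]/(enc_tuple _) /rtask_args /= /enc_task.
rewrite enc_raw_form enc_raw_state; do ![congr cons | congr enc_tuple].
rewrite -[LHS]/(enc_seq _) -map_comp; congr enc_seq; apply: eq_map => X /=.
exact: enc_raw_action.
Qed.

Lemma solvable_raw T : NFL_task T -> solvable (raw_task T) <-> has_solution T.
Proof.
move=> nflT; have I_gt0 := agent_gt0 T.
have props_acts X :
    List.In X (actions T) -> {subset action_props X <= task_props T}.
  move=> X_acts p pX; rewrite mem_undup mem_cat; apply/orP; left.
  elim: (actions T) X_acts => //= Y Ys IH [->|/IH].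
    by rewrite mem_cat pX.
  rewrite mem_cat => ->.
  by rewrite orbT.
have props_goal : {subset form_props (goal T) <= task_props T}.
  by move=> p p_goal; rewrite mem_undup mem_cat p_goal orbT.
have reachT k : reachable #|agent T| (bound T) (map raw_action (actions T))
    (raw_form (goal T)) k (rinit (raw_task T)) <-> _ :=
  reachable_raw k I_gt0 (enum_uniq _) (mem_enum _) props_acts props_goal.
rewrite /solvable has_expand /= orbF; apply: iff_trans (reachT _) _.
split=> [[Xs [_ Xs_acts ach]]|[Xs [Xs_acts ach]]]; first by exists Xs.
rewrite /rtask_bound nworlds_raw //= -cardE.
(* Initially every level is at most [bound T], so the sum of the bounds is the attention argument
   used in [rtask_bound]. *)
apply: (short_plan (b := fun _ => bound T)) Xs_acts ach.
- rewrite /max_events; elim: (actions T) => //= Y Ys.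
  by rewrite addn_gt0 orbC => ->.
- move=> X X_acts; split; first exact: nflT.
  elim: (actions T) X_acts => //= Y Ys IH [->|/IH le_X].
    by rewrite /= size_map -cardE leq_addr.
  by rewrite (leq_trans le_X) // leq_addl.
- by [].
- by move=> i w; rewrite -ltnS.
- by rewrite sum_nat_const.
Qed.
End Task.

Theorem theorem25 (Phi : countType) :
  decidable_problem (@enc_task Phi) (@NFL_task Phi) (@has_solution Phi).
Proof.
have [u closed_u u_solvable] := comp_solvable.
exists u => // T nflT; rewrite -enc_raw_task.
(* Excluded middle only splits the verification; the term [u] was fixed before the task. *)
have [solT|nosolT] := pselect (has_solution T); [left | right]; split=> //.
  by rewrite -((solvable_raw nflT).2 solT); apply: u_solvable.
have /negbTE <- : ~~ solvable (raw_task T).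
  by apply/negP => /(solvable_raw nflT).
exact: u_solvable.
Qed.
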